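(* Let $N\ge2$, and fix some starting point $x\in C_N^B$ as well as the parameters $p,q$. Consider the associated diffusions $(\widetilde X_{t,\kappa})_{t\ge0}$ for $\kappa\in\,]0,\infty[$ (with $q\ge p\ge N-1+\frac1{2\kappa}$) started in $x$, and the associated deterministic process $(\widetilde X_{t,\infty})_{t\ge0}$ for $\kappa=\infty$ started in $x$. Then for all $t\ge0$ and $y\in\mathbb C$, $$\mathbb E\Bigl(\prod_{j=1}^N\bigl(y-\cosh(\widetilde X_{t,\kappa,j})\bigr)\Bigr)=\sum_{n=0}^N(-1)^n\,\mathbb E\bigl(e_n(\cosh(\widetilde X_{t,\kappa}))\bigr)\,y^{N-n}=\sum_{n=0}^N(-1)^n\,e_n\bigl(\cosh(\widetilde X_{t,\infty})\bigr)\,y^{N-n}=\prod_{j=1}^N\bigl(y-\cosh(\widetilde X_{t,\infty,j})\bigr)=:D_{t,x}(y).$$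
   Context: $C_N^B=\{x\in\mathbb R^N:x_1\ge\ldots\ge x_N\ge0\}$. The $e_n$ ($n=0,\ldots,N$) are the elementary symmetric polynomials in $N$ variables, and $\cosh$ of a vector is taken componentwise. The parameters satisfy $\kappa>0$, $q\ge p\ge N-1+\frac1{2\kappa}$, and $k_{0,2}:=p-(N-1)-\frac1{2\kappa}\ge0$; $p,q$ are regarded as fixed and $\kappa$ as varying. For finite $\kappa$, $(\widetilde X_{t,\kappa})_{t\ge0}$ is the diffusion on $C_N^B$, with paths reflected at the boundary, with generator $$\widetilde L_\kappa=\frac1\kappa\Delta+\sum_{i=1}^N\Bigl((q-p)\coth\tfrac{x_i}2+2k_{0,2}\coth x_i+\sum_{j\ne i}\bigl(\coth\tfrac{x_i-x_j}2+\coth\tfrac{x_i+x_j}2\bigr)\Bigr)\partial_i$$ acting on functions invariant under the hyperoctahedral group (the non-compact Heckman-Opdam Laplacian of type $BC_N$ with multiplicities $\kappa(q-p),\kappa k_{0,2},\kappa$ on the roots $\pm e_i,\pm2e_i,\pm(e_i\pm e_j)$, respectively, where $e_i$ here denotes the standard basis vectors, divided by $\kappa$); it may be regarded as the solution of the SDE with diffusion part $\frac{\sqrt2}{\sqrt\kappa}dB_{t,j}$ ($B$ an $N$-dimensional Brownian motion) and drift in the $j$-th component given by the coefficient of $\partial_j$ above. For $\kappa=\infty$, $(\widetilde X_{t,\infty})_{t\ge0}$ is the deterministic solution, with start in $x$, of $$\frac{dx_j}{dt}(t)=\sum_{l\ne j}\Bigl(\coth\tfrac{x_j(t)-x_l(t)}2+\coth\tfrac{x_j(t)+x_l(t)}2\Bigr)+(q-p)\coth\tfrac{x_j(t)}2+2(p-(N-1))\coth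 x_j(t)\quad(j=1,\ldots,N).$$ For initial data in the interior of $C_N^B$ this solution exists for all $t\ge0$ in the interior of $C_N^B$; for the boundary starting point $x=0$, unique solvability of the initial value problem is only expected, not proved. *)

(* Defs.v *)
(* [mpoly] is required without being imported: its notations clash with those
   of MathComp-Analysis. *)
From HB Require Import structures.
From mathcomp Require Import all_boot all_order all_algebra all_fingroup.
From mathcomp Require Import complex.
From mathcomp Require Import all_classical all_reals all_analysis.
From mathcomp.multinomials Require mpoly.

Set Implicit Arguments.
Unset Strict Implicit.
Unset Printing Implicit Defensive.

Import Order.TTheory GRing.Theory Num.Theory.
Import numFieldNormedType.Exports.

Local Open Scope classical_set_scope.
Local Open Scope ring_scope.

Definition cosh {R : realType} (x : R) : R := (expR x + expR (- x)) / 2.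
Definition sinh {R : realType} (x : R) : R := (expR x - expR (- x)) / 2.

(* [coth 0 = 0] by the convention on inverses; below, [coth] is only ever
   evaluated at nonzero arguments, because the generator and the ODE are only
   considered in the interior of the chamber. *)
Definition coth {R : realType} (x : R) : R := cosh x / sinh x.

Definition coshv {R : realType} {N : nat} (x : 'rV[R]_N) : 'rV[R]_N :=
  map_mx cosh x.

Definition elem_sym {R : realType} {N : nat} (n : nat) (x : 'rV[R]_N) : R :=
  mpoly.meval (fun i : 'I_N => x 0 i) (mpoly.mesym N R n).

Definition weylB (R : realType) (N : nat) : set 'rV[R]_N :=
  [set x : 'rV[R]_N | (forall i j : 'I_N, (i <= j)%N -> x 0 j <= x 0 i) /\
                    (forall i : 'I_N, 0 <= x 0 i)].
Arguments weylB : clear implicits.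

Definition signed_perm {R : realType} {N : nat} (s : {perm 'I_N})
    (eps : {ffun 'I_N -> bool}) (x : 'rV[R]_N) : 'rV[R]_N :=
  \row_i ((-1) ^+ eps i * x 0 (s i)).

Definition hyperoctahedral_invariant {R : realType} {N : nat}
    (f : 'rV[R]_N -> R) : Prop :=
  forall (s : {perm 'I_N}) (eps : {ffun 'I_N -> bool}) (x : 'rV[R]_N),
    f (signed_perm s eps x) = f x.

Definition partial {R : realType} {N : nat} (i : 'I_N) (f : 'rV[R]_N -> R) :
    'rV[R]_N -> R :=
  fun x => 'D_(delta_mx 0 i) f x.

Definition has_partial {R : realType} {N : nat} (i : 'I_N)
    (f : 'rV[R]_N -> R) : Prop :=
  forall x, derivable f x (delta_mx 0 i).

Definition C2 {R : realType} {N : nat} (f : 'rV[R]_N -> R) : Prop :=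
  [/\ continuous f,
      forall i, has_partial i f /\ continuous (partial i f) &
      forall i j, has_partial j (partial i f) /\
                  continuous (partial j (partial i f))].

Definition compactly_supported {R : realType} {N : nat}
    (f : 'rV[R]_N -> R) : Prop :=
  compact (closure [set x : 'rV[R]_N | f x != 0]).

(* The coefficient of the i-th partial derivative, with the coefficients of
   coth (x_i / 2) and 2 coth x_i left as parameters. *)
Definition drift {R : realType} {N : nat} (a k : R) (x : 'rV[R]_N)
    (i : 'I_N) : R :=
  \sum_(j < N | j != i)
     (coth ((x 0 i - x 0 j) / 2) + coth ((x 0 i + x 0 j) / 2))
  + a * coth (x 0 i / 2) + 2 * k * coth (x 0 i).

Definition k02 {R : realType} (N : nat) (p kappa : R) : R :=
  p - (N%:R - 1) - (2 * kappa)^-1.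

Definition generator {R : realType} {N : nat} (p q kappa : R)
    (f : 'rV[R]_N -> R) (x : 'rV[R]_N) : R :=
  kappa^-1 * \sum_(i < N) partial i (partial i f) x
  + \sum_(i < N) drift (q - p) (k02 N p kappa) x i * partial i f x.

Definition natural_filtration {R : realType} {N : nat} {T : Type}
    (X : R -> T -> 'rV[R]_N) (t : R) : set (set T) :=
  <<s [set A | exists (r : R) (i : 'I_N) (B : set R),
         [/\ 0 <= r <= t, measurable B & A = (fun w => X r w 0 i) @^-1` B] ] >>.

Definition martingale {R : realType} {d : measure_display}
    {T : measurableType d} (P : probability T R) (F : R -> set (set T))
    (M : R -> T -> R) : Prop :=
  [/\ forall t : R, 0 <= t -> P.-integrable setT (EFin \o M t),
      forall t : R, 0 <= t -> forall B : set R, measurable B -> F t (M t @^-1` B) &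
      forall s t : R, 0 <= s <= t -> forall A, F s A ->
        \int[P]_(w in A) M t w = \int[P]_(w in A) M s w].

(* The diffusion on the chamber with the generator above, reflected at the
   boundary and started in x, as a solution of the martingale problem for the
   generator acting on (compactly supported, C^2) functions invariant under the
   hyperoctahedral group.  For such f the function [generator p q kappa f] on
   the interior of the chamber extends continuously to the closed chamber; g is
   that extension.  Reflection at the boundary is encoded by the
   invariance of f (which includes a Neumann condition on each wall) and by the
   use of g, rather than other values, on the boundary (which excludes sticky
   behaviour); it covers walls with multiplicity 0, such as x_N = 0 if
   q = p and k02 = 0, where the SDE needs an additional local time. *)
Definition is_diffusion {R : realType} {N : nat} {d : measure_display}
    {T : measurableType d} (P : probability T R) (p q kappa : R)
    (x : 'rV[R]_N) (X : R -> T -> 'rV[R]_N) : Prop :=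
  [/\ forall t : R, 0 <= t -> forall i : 'I_N,
        measurable_fun setT (fun w : T => X t w 0 i),
      forall (w : T) (t : R), 0 <= t -> weylB R N (X t w),
      forall w, {within [set t : R | 0 <= t], continuous (fun t => X t w)},
      {ae P, forall w, X 0 w = x} &
      forall f g : 'rV[R]_N -> R,
        C2 f -> compactly_supported f -> hyperoctahedral_invariant f ->
        {within weylB R N, continuous g} ->
        (forall z, (weylB R N)° z -> g z = generator p q kappa f z) ->
        martingale P (natural_filtration X)
          (fun t w => f (X t w) - f (X 0 w)
             - \int[lebesgue_measure]_(s in `[0, t]) g (X s w))].

(* A solution of the ODE started in x; x may lie on the boundary, where the
   right-hand side is not defined, so the equation is imposed for t > 0
   together with continuity at t = 0. *)
Definition is_deterministic_solution {R : realType} {N : nat} (p q : R)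
    (x : 'rV[R]_N) (Y : R -> 'rV[R]_N) : Prop :=
  [/\ Y 0 = x,
      {within [set t : R | 0 <= t], continuous Y},
      forall t : R, 0 < t -> (weylB R N)° (Y t) &
      forall t : R, 0 < t -> forall j : 'I_N,
        is_derive t 1 (fun s => Y s 0 j)
          (drift (q - p) (p - (N%:R - 1)) (Y t) j)].

Definition cintegrable {R : realType} {d : measure_display}
    {T : measurableType d} (P : probability T R) (Z : T -> R[i]) : Prop :=
  P.-integrable setT (EFin \o (fun w => complex.Re (Z w))) /\
  P.-integrable setT (EFin \o (fun w => complex.Im (Z w))).

Definition cexpectation {R : realType} {d : measure_display}
    {T : measurableType d} (P : probability T R) (Z : T -> R[i]) : R[i] :=
  Complex (fine 'E_P[fun w => complex.Re (Z w)])
          (fine 'E_P[fun w => complex.Im (Z w)]).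

(* Main.v *)
Require Import Defs.
From HB Require Import structures.
From mathcomp Require Import all_boot all_order all_algebra all_fingroup.
From mathcomp Require Import complex.
From mathcomp Require Import all_classical all_reals all_analysis.
From mathcomp.multinomials Require mpoly.
From mathcomp Require Import measurable_realfun.
From mathcomp Require Import ring lra.

(* The drift is designed so that the generator maps the elementary symmetric
   polynomials e_n in z_i = cosh x_i to combinations of e_n, e_(n-1), e_(n-2).
   For the generating function W_u(x) = prod_i (u + z_i), u > 0, this reads
     L W = (q - p) (N W + (1 - u) W') + 2 (p - N + 1) (N W - u W')
           + N (N - 1) W + (1 - u^2) W'',
   the primes being derivatives in u.  The contribution N W - u W' of the
   Laplacian over kappa cancels the term -1/(2 kappa) of k02, so kappa disappears
   and the same linear ODE in the space of polynomials in u of degree at most N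
   governs E W_u(X_t) and W_u(Y_t); it has a unique solution.

   Only compactly supported test functions are available for X.  The functions
   (m/3) (1 - W/m)_+^3 are used: m/3 minus this is concave and bounded in W,
   and increases to W with m.  As L W <= C W, Gronwall's lemma gives moment
   bounds uniform in m, then Fatou's lemma and dominated convergence give
   Dynkin's formula for W itself. *)

Set Implicit Arguments.
Unset Strict Implicit.
Unset Printing Implicit Defensive.

Import Order.TTheory GRing.Theory Num.Theory.
Import numFieldNormedType.Exports.

Local Open Scope classical_set_scope.
Local Open Scope ring_scope.

(** * Hyperbolic functions and the drift *)

Section Hyperbolic.
Context {R : realType}.
Implicit Types x y : R.

(** Two obstacles shape the proof: the drift is singular at the walls, where the starting point may
    lie, and the interesting functions are unbounded. Polynomials in the cosh x_i are regular across
    the walls, so a boundary start enters only through continuity at time 0, and both processes are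
    compared as curves in a finite-dimensional space of polynomials. The restriction u > 0 makes
    each factor u + cosh x_i at least 1: reciprocals are bounded, and W controls cosh x_i and its
    own generator. Complex y never enters the analysis: values at N + 1 positive u determine a
    polynomial of degree at most N through a Vandermonde matrix, and y is inserted once the
    coefficients agree. Each cutoff has a differentiable expectation, but only the time-integrated
    identity passes to the limit in m. Differentiability is recovered afterwards from finite
    dimension: the expected generator is a fixed linear combination of the expectations of the e_n,
    hence continuous in time. *)

Lemma cosh_ge1 x : 1 <= cosh x.
Proof.
have := expR_gt0 x; have := expR_gt0 (- x); have := expRxMexpNx_1 x.
rewrite /cosh; set a := expR x; set b := expR (- x) => ab b0 a0.
have : 0 <= (a - b) ^+ 2 by exact: sqr_ge0.
have : 0 <= a + b by lra.
nra.
Qed.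

Lemma coshN x : cosh (- x) = cosh x.
Proof. by rewrite /cosh opprK addrC. Qed.

Lemma cosh_sinhE x : cosh x ^+ 2 - sinh x ^+ 2 = 1.
Proof. by rewrite -[RHS](expRxMexpNx_1 x) /cosh /sinh; field. Qed.

Lemma sinh_eq0 x : (sinh x == 0) = (x == 0).
Proof.
rewrite /sinh mulf_eq0 invr_eq0 pnatr_eq0 orbF subr_eq0.
rewrite (inj_eq (@expR_inj R)) -subr_eq0 opprK -mulr2n -mulr_natl mulf_eq0 pnatr_eq0.
by [].
Qed.

Lemma ler_norm_sinh_cosh x : `|sinh x| <= cosh x.
Proof.
rewrite /sinh /cosh ler_norml; have := expR_gt0 x; have := expR_gt0 (- x).
by move=> *; apply/andP; split; lra.
Qed.

Lemma ler_norm_cosh x : `|x| <= 2 * cosh x.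
Proof.
rewrite /cosh ler_norml; have := expR_ge1Dx x; have := expR_ge1Dx (- x).
have := expR_gt0 x; have := expR_gt0 (- x).
by move=> *; apply/andP; split; lra.
Qed.

Lemma sinhD x y : sinh (x + y) = sinh x * cosh y + cosh x * sinh y.
Proof. by rewrite /sinh /cosh opprD !expRD; field. Qed.

Lemma coshD x y : cosh (x + y) = cosh x * cosh y + sinh x * sinh y.
Proof. by rewrite /sinh /cosh opprD !expRD; field. Qed.

(** As sinh x_i is the derivative of cosh x_i, each [coth] of the drift meets a factor [sinh]; the
    resulting products are rational in the hyperbolic cosines. *)
Lemma coth_halfM_sinh x : x != 0 -> coth (x / 2) * sinh x = cosh x + 1.
Proof.
move=> x0; have s0 : sinh (x / 2) != 0 by rewrite sinh_eq0 mulf_neq0// invr_neq0.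
rewrite (splitr x) sinhD coshD -splitr /coth.
have e := cosh_sinhE (x / 2); set c := cosh _ in e *; set d := sinh _ in e s0 *.
transitivity (c * c + d * d + (c ^+ 2 - d ^+ 2)); last by rewrite e.
by field.
Qed.

Lemma cothM_sinh x : x != 0 -> coth x * sinh x = cosh x.
Proof. by move=> x0; rewrite /coth mulfVK// sinh_eq0. Qed.

Lemma cosh_sub x y :
  cosh x - cosh y = 2 * (sinh ((x + y) / 2) * sinh ((x - y) / 2)).
Proof.
have -> : cosh x = cosh ((x + y) / 2 + (x - y) / 2) by congr cosh; field.
have -> : cosh y = cosh ((x + y) / 2 + - ((x - y) / 2)) by congr cosh; field.
have sN z : sinh (- z) = - sinh z :> R by rewrite /sinh opprK; field.
by rewrite !coshD coshN sN; ring.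
Qed.

(** With a = (x - y) / 2 and b = (x + y) / 2, coth a + coth b = sinh (a + b) / (sinh a sinh b), and
    [cosh_sub] turns the denominator into (cosh x - cosh y) / 2. *)
Lemma coth_pairM_sinh x y : cosh x != cosh y ->
  (coth ((x - y) / 2) + coth ((x + y) / 2)) * sinh x
  = 2 * (cosh x ^+ 2 - 1) / (cosh x - cosh y).
Proof.
rewrite -subr_eq0 cosh_sub mulf_eq0 negb_or => /andP[_].
rewrite mulf_eq0 negb_or => /andP[a0 b0].
have -> : cosh x ^+ 2 - 1 = sinh x ^+ 2 by rewrite -(cosh_sinhE x); ring.
have -> : sinh x = sinh ((x + y) / 2 + (x - y) / 2) by congr sinh; field.
by rewrite !sinhD /coth; field; rewrite b0 a0.
Qed.

End Hyperbolic.

Section DriftAlgebra.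
Context {R : realType} {N : nat}.

(* Adding the terms (i, j) and (j, i) cancels the denominators. *)
Lemma pair_interaction_sum (u : R) (z : 'I_N -> R) :
  (forall i, u + z i != 0) -> (forall i j, i != j -> z i != z j) ->
  let r i := (u + z i)^-1 in
  \sum_(i < N) \sum_(j < N | j != i) (2 * (z i ^+ 2 - 1) / (z i - z j) * r i)
  = N%:R * (N%:R - 1)
    + (1 - u ^+ 2) * ((\sum_i r i) ^+ 2 - \sum_i r i ^+ 2).
Proof.
move=> u0 zij r; set G := fun i j => 2 * (z i ^+ 2 - 1) / (z i - z j) * r i.
rewrite -/(G _ _); set S := LHS.
have Ssym : S = \sum_(i < N) \sum_(j < N | j != i) G j i.
  rewrite /S (exchange_big_dep predT)//=; apply: eq_bigr => i _.
  by apply: eq_bigl => j; rewrite eq_sym.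
have GG i j : j != i -> G i j + G j i = 2 * (1 + (1 - u ^+ 2) * (r i * r j)).
  move=> ji; rewrite /G /r; field.
  by rewrite !u0 /= !subr_eq0 zij// 1?eq_sym// zij// eq_sym.
have : S + S = 2 * (N%:R * (N%:R - 1)
    + (1 - u ^+ 2) * ((\sum_i r i) ^+ 2 - \sum_i r i ^+ 2)).
  rewrite {2}Ssym -big_split/=.
  transitivity (\sum_(i < N) 2 * ((N%:R - 1) + (1 - u ^+ 2)
                  * (r i * (\sum_j r j) - r i ^+ 2))).
    apply: eq_bigr => i _; rewrite -big_split/=.
    under eq_bigr => j ji do rewrite GG//.
    rewrite -mulr_sumr big_split/= -mulr_sumr -mulr_sumr.
    have -> : \sum_(j < N | j != i) r j = (\sum_j r j) - r i.
      by rewrite [in RHS](bigD1 i)//= addrAC subrr add0r.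
    have -> : \sum_(j < N | j != i) 1 = N%:R - 1 :> R.
      rewrite -[in RHS](card_ord N) -sumr_const.
      by rewrite [in RHS](bigD1 i)//= addrAC subrr add0r.
    by rewrite mulrBr expr2.
  rewrite -mulr_sumr big_split/= sumr_const card_ord -mulr_sumr sumrB.
  rewrite -mulr_suml -[X in 2 * (_ + _ * (X - _))]expr2.
  by rewrite -[(N%:R - 1) *+ N]mulr_natl.
by move: (N%:R * (N%:R - 1) + _) => B; lra.
Qed.

(** The function W_u of the overview: up to the factor (-1)^N, the product in the theorem at y =
    -u. *)
Definition coshprod (u : R) (x : 'rV[R]_N) : R :=
  \prod_(i < N) (u + cosh (x 0 i)).

(** The logarithmic derivative of [coshprod] in u. The second derivative divided by [coshprod] is
    the square of [recip_sum] minus [recip_sqr_sum]. *)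
Definition recip_sum (u : R) (x : 'rV[R]_N) : R :=
  \sum_(i < N) (u + cosh (x 0 i))^-1.

Definition recip_sqr_sum (u : R) (x : 'rV[R]_N) : R :=
  \sum_(i < N) (u + cosh (x 0 i))^-1 ^+ 2.

(** The logarithmic derivative of [coshprod u] in the coordinate x_i. *)
Definition sinh_ratio (u : R) (i : 'I_N) (x : 'rV[R]_N) : R :=
  sinh (x 0 i) / (u + cosh (x 0 i)).

Lemma add_cosh_ge1 (u y : R) : 0 < u -> 1 <= u + cosh y.
Proof. by move=> u0; have := cosh_ge1 y; lra. Qed.

Lemma add_cosh_gt0 (u y : R) : 0 < u -> 0 < u + cosh y.
Proof. by move=> u0; exact: lt_le_trans (add_cosh_ge1 y u0). Qed.

Lemma nbhs_line (x v : 'rV[R]_N) (A : set 'rV[R]_N) :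
  nbhs x A -> exists2 h : R, 0 < h & A (x + h *: v).
Proof.
move=> xA.
have : x + h *: v @[h --> (0 : R)] --> x.
  rewrite -[X in _ --> X]addr0 -(scale0r v).
  by apply: cvgD; [exact: cvg_cst|apply: cvgZr_tmp; exact: cvg_id].
move=> /(_ _ xA) xvA.
near (0 : R)^'+ => h; exists h => //; near: h.
exact: (cvg_at_right_filter _ xvA).
Unshelve. all: by end_near. Qed.

(** An interior point can be pushed slightly along -e_i without leaving the chamber, which makes
    each defining inequality strict; [cosh_sub] then separates the hyperbolic cosines. *)
Lemma interior_weylB (x : 'rV[R]_N) : (weylB R N)° x ->
  (forall i, x 0 i != 0) /\ (forall i j, i != j -> cosh (x 0 i) != cosh (x 0 j)).
Proof.
move=> xW; have [xdec x0] := interior_subset xW.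
have xpos i : 0 < x 0 i.
  have [h h0 [_ /(_ i)]] := nbhs_line (- delta_mx 0 i) xW.
  by rewrite !mxE !eqxx/=; lra.
have xlt (i j : 'I_N) : (i < j)%N -> x 0 j < x 0 i.
  move=> ij; have [h h0 [+ _]] := nbhs_line (- delta_mx 0 i) xW.
  move=> /(_ i j (ltnW ij)); rewrite !mxE !eqxx/=.
  by rewrite (_ : j == i = false) ?gtn_eqF//=; [lra|rewrite -val_eqE gtn_eqF].
split=> [i|i j ij]; first by rewrite gt_eqF.
rewrite -subr_eq0 cosh_sub mulf_neq0 ?pnatr_eq0//.
apply: mulf_neq0; rewrite sinh_eq0 mulf_neq0 ?invr_eq0 ?pnatr_eq0//.
- by rewrite gt_eqF// addr_gt0.
- rewrite subr_eq0; move: ij; rewrite -val_eqE neq_ltn => /orP[]/xlt.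
  + by move=> /gt_eqF ->.
  + by move=> /lt_eqF ->.
Qed.

Lemma drift_sinh_ratio_sum (a k u : R) (x : 'rV[R]_N) : 0 < u ->
  (weylB R N)° x ->
  \sum_(i < N) drift a k x i * sinh_ratio u i x
  = a * (N%:R + (1 - u) * recip_sum u x)
    + 2 * k * (N%:R - u * recip_sum u x)
    + N%:R * (N%:R - 1)
    + (1 - u ^+ 2) * (recip_sum u x ^+ 2 - recip_sqr_sum u x).
Proof.
move=> u0 /interior_weylB[x0 xij].
have uz i : u + cosh (x 0 i) != 0 by rewrite gt_eqF// add_cosh_gt0.
rewrite -addrA -[X in _ + X](pair_interaction_sum uz xij)/=.
transitivity (\sum_(i < N) (a * (1 + (1 - u) * (u + cosh (x 0 i))^-1)
    + 2 * k * (1 - u * (u + cosh (x 0 i))^-1)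
    + \sum_(j < N | j != i) (2 * (cosh (x 0 i) ^+ 2 - 1)
         / (cosh (x 0 i) - cosh (x 0 j)) * (u + cosh (x 0 i))^-1))).
  apply: eq_bigr => i _; rewrite -mulr_suml.
  under [in RHS]eq_bigr => j ji.
    rewrite -coth_pairM_sinh; last by rewrite xij// eq_sym.
    over.
  rewrite -mulr_suml /drift /sinh_ratio; move: (uz i).
  have := coth_halfM_sinh (x0 i); have := cothM_sinh (x0 i).
  move: (\sum_(j < N | _) _) (coth _) (coth _) (sinh _) (cosh _).
  move=> S A B s c Bs As uc.
  transitivity ((S * s + a * (A * s) + 2 * k * (B * s)) / (u + c)); first by ring.
  by rewrite As Bs; field.
rewrite big_split big_split/=; congr (_ + _ + _).
  by rewrite -mulr_sumr big_split/= sumr_const card_ord -mulr_sumr.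
by rewrite -mulr_sumr sumrB/= sumr_const card_ord -mulr_sumr.
Qed.

End DriftAlgebra.

(** * Directional derivatives *)

Section DirectionalDerivatives.
Context {R : realType} {V : normedModType R}.
Implicit Types (f g : V -> R) (x v : V).

(** Restriction to a line reduces directional derivatives to one real variable, where the chain rule
    asks for a derivative and not for differentiability on [V]. *)
Lemma is_derive_lineP f x v (df : R) :
  is_derive x v f df <-> is_derive (0 : R) 1 (fun h => f (h *: v + x)) df.
Proof.
have E : 'D_v f x = 'D_1 (fun h : R => f (h *: v + x)) 0.
  rewrite /derive; set g1 := fun h => h^-1 *: _; set g2 := fun h => h^-1 *: _.
  suff -> : g1 = g2 by [].
  rewrite funeqE /g1 /g2 => h /=.
  by rewrite addr0 scale0r add0r [_%:A]mulr1.
split=> -[d1 d2].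
- by split; [have [+ _] := derivable1P f x v; apply|rewrite -E].
- by split; [have [_ +] := derivable1P f x v; apply|rewrite E].
Qed.

Lemma is_derive_comp_scalar (F : R -> R) f x v (dF df : R) :
  is_derive (f x) 1 F dF -> is_derive x v f df ->
  is_derive x v (F \o f) (dF * df).
Proof.
move=> hF /is_derive_lineP hf; apply/is_derive_lineP.
apply: (@is_derive1_comp _ F (fun h : R => f (h *: v + x))) => //.
by rewrite scale0r add0r.
Qed.

Lemma is_derive_val f x v (df df' : R) :
  is_derive x v f df -> df = df' -> is_derive x v f df'.
Proof. by move=> ? <-. Qed.

Lemma is_derive_mul f g x v (df dg : R) :
  is_derive x v f df -> is_derive x v g dg ->
  is_derive x v (fun y => f y * g y) (df * g x + f x * dg).
Proof.
move=> hf hg; rewrite addrC [df * _]mulrC.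
exact: (@is_deriveM R V f g x v df dg hf hg).
Qed.

Lemma is_derive_add f g x v (df dg : R) :
  is_derive x v f df -> is_derive x v g dg ->
  is_derive x v (fun y => f y + g y) (df + dg).
Proof. by move=> hf hg; exact: (@is_deriveD R V R f g x v df dg hf hg). Qed.

Lemma is_derive_prod_log (I : Type) (s : seq I) (F : I -> V -> R) (dF : I -> R)
    x v : (forall i, F i x != 0) -> (forall i, is_derive x v (F i) (dF i)) ->
  is_derive x v (fun y => \prod_(i <- s) F i y)
    ((\prod_(i <- s) F i x) * \sum_(i <- s) dF i / F i x).
Proof.
move=> F0 hF; elim: s => [|i s IH].
  under eq_fun do rewrite big_nil.
  by rewrite !big_nil mulr0; exact: is_derive_cst.
under eq_fun do rewrite big_cons.
rewrite !big_cons; apply: (is_derive_val (is_derive_mul (hF i) IH)).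
by have := F0 i; move=> ?; field.
Qed.

End DirectionalDerivatives.

Section HyperbolicDerivatives.
Context {R : realType}.

Lemma is_derive_cosh (x : R) : is_derive x 1 cosh (sinh x).
Proof.
rewrite /cosh /sinh.
have h : is_derive x 1 (fun y : R => expR (- y)) (- expR (- x)).
  apply: (is_derive_val (is_derive1_comp (is_derive_expR _) (is_deriveNid x 1))).
  by rewrite mulrN1.
apply: (is_derive_val (is_derive_mul (is_derive_add (is_derive_expR x) h)
  (is_derive_cst _ _ _))).
by rewrite mulr0 addr0.
Qed.

Lemma is_derive_sinh (x : R) : is_derive x 1 sinh (cosh x).
Proof.
rewrite /cosh /sinh.
have h : is_derive x 1 (fun y : R => expR (- y)) (- expR (- x)).
  apply: (is_derive_val (is_derive1_comp (is_derive_expR _) (is_deriveNid x 1))).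
  by rewrite mulrN1.
apply: (is_derive_val (is_derive_mul (is_deriveB (is_derive_expR x) h)
  (is_derive_cst _ _ _))).
by rewrite mulr0 addr0 opprK.
Qed.

(** The square of the positive part is C^1, so its cube is C^2: this is why the cutoffs are
    cubic. *)
Lemma is_derive_sqr_pos (x : R) :
  is_derive x 1 (fun y => Num.max 0 y ^+ 2) (2 * Num.max 0 x).
Proof.
have [x0|x0|->] := ltgtP x 0.
- rewrite mulr0; apply: (@near_eq_is_derive _ _ _ (cst 0)).
    near=> y; rewrite /= max_l ?expr0n//; apply: ltW.
  by near: y; exact: lt_nbhsl.
- have dx : is_derive x 1 (fun y : R => y * y) (2 * x).
    apply: (is_derive_val (is_derive_mul (is_derive_id _ _) (is_derive_id _ _))).
    by rewrite mul1r mulr1 mulr2n mulrDl mul1r.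
  apply: near_eq_is_derive dx.
  near=> y; rewrite /= max_r ?expr2//; apply: ltW.
  by near: y; exact: lt_nbhsr.
(* At the kink the difference quotient with increment h is just max 0 h. *)
- have lim0 : (fun h : R => h^-1 *: (Num.max 0 (h *: 1 + 0 : R) ^+ 2
      - Num.max 0 (0 : R) ^+ 2)) @ (0 : R)^' --> (0 : R).
    rewrite maxxx expr0n/=.
    apply: (@cvg_trans _ ((fun h => Num.max 0 h) @ (0 : R)^')).
      apply: near_eq_cvg; near=> h.
      have h0 : h != 0 by near: h; exact: nbhs_dnbhs_neq.
      rewrite /GRing.scale/= mulr1 addr0 subr0.
      have [h1|h1] := leP h 0; first by rewrite expr0n mulr0.
      by rewrite expr2 mulKf.
    have c0 : {for (0 : R), continuous (fun y : R => Num.max 0 y)}.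
      by apply: (@continuous_max R R (cst 0) id); [exact: cvg_cst|exact: cvg_id].
    by move: c0; rewrite /prop_for /continuous_at maxxx; exact: cvg_within_filter.
  rewrite mulr0; split; first by apply/cvg_ex; exists 0.
  exact: (cvg_lim (@Rhausdorff R) lim0).
Unshelve. all: by end_near. Qed.

Lemma is_derive_coord n (x v : 'rV[R]_n) i :
  is_derive x v (fun y : 'rV[R]_n => y 0 i) (v 0 i).
Proof.
apply/is_derive_lineP.
under eq_fun do rewrite !mxE.
apply: (is_derive_val (is_derive_add (is_derive_mul (is_derive_id _ _)
  (is_derive_cst _ _ _)) (is_derive_cst _ _ _))).
by rewrite mul1r mulr0 !addr0.
Qed.

End HyperbolicDerivatives.

(** * The generator on functions of a product of hyperbolic cosines *)

Section Continuity.
Context {R : realType} {T : topologicalType}.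
Implicit Types f g : T -> R.

Lemma continuous_mulf f g :
  continuous f -> continuous g -> continuous (fun x => f x * g x).
Proof.
move=> cf cg x; exact: (@cvgM R T (nbhs x) _ f g (f x) (g x) (cf x) (cg x)).
Qed.

Lemma continuous_addf f g :
  continuous f -> continuous g -> continuous (fun x => f x + g x).
Proof.
move=> cf cg x; exact: (@cvgD R R T (nbhs x) _ f g (f x) (g x) (cf x) (cg x)).
Qed.

Lemma continuous_invf f :
  (forall x, f x != 0) -> continuous f -> continuous (fun x => (f x)^-1).
Proof.
move=> f0 cf x; exact: (@cvgV R T (nbhs x) _ f (f x) (f0 x) (cf x)).
Qed.

Lemma continuous_const (c : R) : continuous (fun _ : T => c).
Proof. by move=> x; exact: cvg_cst. Qed.

End Continuity.

Section CoshProduct.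
Context {R : realType} {N : nat} (u : R) (u_gt0 : 0 < u).

(** Composition with [Y] lets one formula serve twice: with [Y = id] for the partial derivatives,
    and with a solution of the ODE for the time derivative. *)
Lemma is_derive_coshprod (V : normedModType R) (Y : V -> 'rV[R]_N) (x v : V)
    (dY : 'I_N -> R) :
  (forall i, is_derive x v (fun y => Y y 0 i) (dY i)) ->
  is_derive x v (fun y => coshprod u (Y y))
    (coshprod u (Y x) * \sum_i dY i * sinh_ratio u i (Y x)).
Proof.
move=> hY.
have F0 i : u + cosh (Y x 0 i) != 0 by rewrite gt_eqF// add_cosh_gt0.
have hF i : is_derive x v (fun y => u + cosh (Y y 0 i)) (sinh (Y x 0 i) * dY i).
  apply: (is_derive_val (is_derive_add (is_derive_cst u x v)
    (is_derive_comp_scalar (is_derive_cosh _) (hY i)))).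
  by rewrite add0r.
apply: (is_derive_val (is_derive_prod_log (index_enum _) F0 hF)).
congr (_ * _); apply: eq_bigr => i _.
by rewrite /sinh_ratio [sinh _ * _]mulrC -mulrA.
Qed.

Lemma is_derive_sinh_ratio (x v : 'rV[R]_N) (i : 'I_N) :
  is_derive x v (sinh_ratio u i)
    (v 0 i * ((1 + u * cosh (x 0 i)) / (u + cosh (x 0 i)) ^+ 2)).
Proof.
have c0 : u + cosh (x 0 i) != 0 by rewrite gt_eqF// add_cosh_gt0.
have hD : is_derive (x 0 i) 1 (fun c : R => u + cosh c) (sinh (x 0 i)).
  apply: (is_derive_val (is_derive_add (is_derive_cst u _ _) (is_derive_cosh _))).
  by rewrite add0r.
have hF : is_derive (x 0 i) 1 (fun c : R => sinh c / (u + cosh c))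
    ((1 + u * cosh (x 0 i)) / (u + cosh (x 0 i)) ^+ 2).
  apply: (is_derive_val (is_derive_mul (is_derive_sinh _)
    (is_deriveV (f := fun c => u + cosh c) c0 hD))).
  rewrite /GRing.scale/=; have := cosh_sinhE (x 0 i); move: c0.
  move: (cosh _) (sinh _) => c s c0 cs.
  transitivity ((c ^+ 2 - s ^+ 2 + u * c) / (u + c) ^+ 2); first by field.
  by rewrite cs.
apply: (is_derive_val (is_derive_comp_scalar hF (is_derive_coord x v i))).
by rewrite mulrC.
Qed.

Lemma continuous_cosh : continuous (@cosh R).
Proof.
move=> y; apply: differentiable_continuous; apply/derivable1_diffP.
by have [] := is_derive_cosh y.
Qed.

Lemma continuous_sinh : continuous (@sinh R).
Proof.
move=> y; apply: differentiable_continuous; apply/derivable1_diffP.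
by have [] := is_derive_sinh y.
Qed.

Lemma continuous_cosh_coord (i : 'I_N) :
  continuous (fun x : 'rV[R]_N => cosh (x 0 i)).
Proof.
move=> x; apply: (continuous_comp (f := fun x : 'rV[R]_N => x 0 i)).
  exact: coord_continuous.
exact: continuous_cosh.
Qed.

Lemma continuous_sinh_coord (i : 'I_N) :
  continuous (fun x : 'rV[R]_N => sinh (x 0 i)).
Proof.
move=> x; apply: (continuous_comp (f := fun x : 'rV[R]_N => x 0 i)).
  exact: coord_continuous.
exact: continuous_sinh.
Qed.

Lemma continuous_add_cosh (i : 'I_N) :
  continuous (fun x : 'rV[R]_N => u + cosh (x 0 i)).
Proof.
by apply: continuous_addf; [exact: continuous_const|exact: continuous_cosh_coord].
Qed.

Lemma continuous_recip (i : 'I_N) :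
  continuous (fun x : 'rV[R]_N => (u + cosh (x 0 i))^-1).
Proof.
apply: continuous_invf => [x|]; first by rewrite gt_eqF// add_cosh_gt0.
exact: continuous_add_cosh.
Qed.

Lemma continuous_coshprod : continuous (@coshprod R N u).
Proof.
apply: continuous_big => [|i _]; first exact: mul_continuous.
exact: continuous_add_cosh.
Qed.

Lemma continuous_sinh_ratio (i : 'I_N) : continuous (@sinh_ratio R N u i).
Proof.
by apply: continuous_mulf; [exact: continuous_sinh_coord|exact: continuous_recip].
Qed.

Lemma continuous_recip_sum : continuous (@recip_sum R N u).
Proof.
apply: continuous_big => [|i _]; first exact: add_continuous.
exact: continuous_recip.
Qed.

Lemma continuous_recip_sqr_sum : continuous (@recip_sqr_sum R N u).
Proof.
apply: continuous_big => [|i _]; first exact: add_continuous.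
by apply: continuous_mulf; exact: continuous_recip.
Qed.

Lemma coshprod_ge1 (x : 'rV[R]_N) : 1 <= coshprod u x.
Proof.
rewrite /coshprod; elim/big_rec: _ => // i y _ y1.
by rewrite -[1]mulr1 ler_pM// add_cosh_ge1.
Qed.

Lemma coshprod_gt0 (x : 'rV[R]_N) : 0 < coshprod u x.
Proof. exact: lt_le_trans (coshprod_ge1 x). Qed.

(** The other factors are at least 1. Hence sublevel sets of W are bounded, which gives the cutoffs
    compact support. *)
Lemma cosh_le_coshprod (x : 'rV[R]_N) i : cosh (x 0 i) <= coshprod u x.
Proof.
rewrite /coshprod (bigD1 i)//= -[leLHS]mulr1 ler_pM//.
- by rewrite (le_trans ler01)// cosh_ge1.
- by rewrite lerDr ltW.
- elim/big_rec: _ => // j y _ y1.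
  by rewrite -[1]mulr1 ler_pM// add_cosh_ge1.
Qed.

Lemma ler_norm_sinh_ratio (i : 'I_N) x : `|sinh_ratio u i x| <= 1.
Proof.
rewrite /sinh_ratio normrM normfV [`|u + _|]gtr0_norm ?add_cosh_gt0//.
rewrite ler_pdivrMr ?add_cosh_gt0// mul1r (le_trans (ler_norm_sinh_cosh _))//.
by rewrite lerDr ltW.
Qed.

Lemma sum_unit_le (F : 'I_N -> R) :
  (forall i, 0 <= F i <= 1) -> 0 <= \sum_i F i <= N%:R.
Proof.
move=> F01; rewrite sumr_ge0/=; last by move=> i _; have /andP[] := F01 i.
rewrite -[in leRHS](card_ord N) -sumr_const; apply: ler_sum => i _.
by have /andP[] := F01 i.
Qed.

Lemma recip_le (y : R) : 0 <= (u + cosh y)^-1 <= 1.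
Proof.
by rewrite invr_ge0 (ltW (add_cosh_gt0 _ _))//= invf_le1 ?add_cosh_ge1 ?add_cosh_gt0.
Qed.

Lemma sum_sqr_sinh_ratio_le (x : 'rV[R]_N) :
  0 <= \sum_i sinh_ratio u i x ^+ 2 <= N%:R.
Proof.
apply: sum_unit_le => i; rewrite sqr_ge0/=.
by rewrite -real_normK ?num_real// exprn_ile1// ler_norm_sinh_ratio.
Qed.

Lemma recip_sum_le (x : 'rV[R]_N) : 0 <= recip_sum u x <= N%:R.
Proof. by apply: sum_unit_le => i; exact: recip_le. Qed.

Lemma recip_sqr_sum_le (x : 'rV[R]_N) : 0 <= recip_sqr_sum u x <= N%:R.
Proof.
apply: sum_unit_le => i; have /andP[r0 r1] := recip_le (x 0 i).
by rewrite sqr_ge0/= exprn_ile1.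
Qed.

(* The generator applied to [coshprod u], see [generator_comp_coshprod]. *)
Definition gen_coshprod (p q : R) (x : 'rV[R]_N) : R :=
  coshprod u x *
  ((q - p) * (N%:R + (1 - u) * recip_sum u x)
    + 2 * (p - (N%:R - 1)) * (N%:R - u * recip_sum u x)
    + N%:R * (N%:R - 1)
    + (1 - u ^+ 2) * (recip_sum u x ^+ 2 - recip_sqr_sum u x)).

Lemma continuous_gen_coshprod p q : continuous (gen_coshprod p q).
Proof.
have cC (c : R) : continuous (fun _ : 'rV[R]_N => c) by exact: continuous_const.
have cm (c : R) : continuous (fun x : 'rV[R]_N => c * recip_sum u x).
  by apply: continuous_mulf; [exact: cC|exact: continuous_recip_sum].
apply: continuous_mulf; first exact: continuous_coshprod.
apply: continuous_addf.
  apply: continuous_addf; last exact: cC.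
  apply: continuous_addf; apply: continuous_mulf; try exact: cC.
    by apply: continuous_addf; [exact: cC|exact: cm].
  under eq_fun do rewrite -mulNr.
  by apply: continuous_addf; [exact: cC|exact: cm].
apply: continuous_mulf; first exact: cC.
apply: continuous_addf; first by apply: continuous_mulf; exact: continuous_recip_sum.
under eq_fun do rewrite -mulN1r.
by apply: continuous_mulf; [exact: cC|exact: continuous_recip_sqr_sum].
Qed.

(** Every reciprocal lies in [0, 1], so both sums lie in [0, N] and the bracket in [gen_coshprod] is
    bounded. This makes W a Lyapunov function. *)
Lemma gen_coshprod_bound p q :
  exists2 C : R, 0 <= C & forall x, `|gen_coshprod p q x| <= C * coshprod u x.
Proof.
pose n := N%:R : R; have n0 : 0 <= n by exact: ler0n.
pose C := `|q - p| * (n + `|1 - u| * n) + `|2 * (p - (n - 1))| * (n + u * n)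
  + `|n * (n - 1)| + `|1 - u ^+ 2| * (n ^+ 2 + n).
exists C => [|x].
  by rewrite !addr_ge0// mulr_ge0// addr_ge0// ?mulr_ge0// ?sqr_ge0// ltW.
rewrite /gen_coshprod normrM gtr0_norm ?coshprod_gt0// mulrC.
rewrite ler_pM2r ?coshprod_gt0//.
have /andP[S0 SN] := recip_sum_le x; have /andP[T0 TN] := recip_sqr_sum_le x.
move: (recip_sum u x) (recip_sqr_sum u x) S0 SN T0 TN => S T S0 SN T0 TN.
rewrite -/n in SN TN *; have uge0 := ltW u_gt0.
apply: le_trans (ler_normD _ _) _; apply: lerD; last first.
  rewrite normrM ler_wpM2l// (le_trans (ler_normB _ _))// lerD//.
    by rewrite ger0_norm ?sqr_ge0// lerXn2r.
  by rewrite ger0_norm.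
apply: le_trans (ler_normD _ _) _; apply: lerD => //.
apply: le_trans (ler_normD _ _) _; apply: lerD; rewrite normrM ler_wpM2l//.
- rewrite (le_trans (ler_normD _ _))// (ger0_norm n0) lerD2l.
  by rewrite normrM (ger0_norm S0) ler_wpM2l.
- rewrite (le_trans (ler_normB _ _))// (ger0_norm n0) lerD2l.
  by rewrite ger0_norm ?mulr_ge0// ler_wpM2l.
Qed.

End CoshProduct.

Section GeneratorComposition.
Context {R : realType} {N : nat} (u : R) (u_gt0 : 0 < u).
Variables theta theta1 theta2 : R -> R.
Hypothesis theta_derive : forall v : R, is_derive v 1 theta (theta1 v).
Hypothesis theta1_derive : forall v : R, is_derive v 1 theta1 (theta2 v).
Hypothesis theta2_continuous : continuous theta2.

Local Notation W := (@coshprod R N u).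
Local Notation r := (@sinh_ratio R N u).

Let theta_continuous : continuous theta.
Proof.
move=> y; apply: differentiable_continuous; apply/derivable1_diffP.
by have [] := theta_derive y.
Qed.

Let theta1_continuous : continuous theta1.
Proof.
move=> y; apply: differentiable_continuous; apply/derivable1_diffP.
by have [] := theta1_derive y.
Qed.

Let continuous_compW (F : R -> R) : continuous F -> continuous (F \o W).
Proof.
move=> cF x; apply: continuous_comp; first exact: continuous_coshprod.
exact: cF.
Qed.

Lemma is_derive_coshprod_coord (x : 'rV[R]_N) i :
  is_derive x (delta_mx 0 i) W (W x * r i x).
Proof.
apply: (is_derive_val (is_derive_coshprod u_gt0 (Y := id)
  (fun j => is_derive_coord x (delta_mx 0 i) j))).
rewrite (bigD1 i)//= mxE !eqxx mul1r big1 ?addr0// => j ji.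
by rewrite mxE (negbTE ji) andbF mul0r.
Qed.

Lemma is_derive_comp_coshprod (x : 'rV[R]_N) i :
  is_derive x (delta_mx 0 i) (theta \o W) (theta1 (W x) * (W x * r i x)).
Proof.
exact: is_derive_comp_scalar (theta_derive _) (is_derive_coshprod_coord x i).
Qed.

Lemma partial_comp_coshprod i :
  partial i (theta \o W) = (fun x => theta1 (W x) * (W x * r i x)).
Proof.
apply/funext => x; rewrite /partial.
by have [_ ->] := is_derive_comp_coshprod x i.
Qed.

Lemma is_derive2_comp_coshprod (x : 'rV[R]_N) i j :
  is_derive x (delta_mx 0 j) (partial i (theta \o W))
   (theta2 (W x) * W x ^+ 2 * (r j x * r i x)
    + theta1 (W x) * W x * (r j x * r i x
       + (i == j)%:R * ((1 + u * cosh (x 0 i)) / (u + cosh (x 0 i)) ^+ 2))).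
Proof.
rewrite partial_comp_coshprod.
apply: (is_derive_val (is_derive_mul
  (is_derive_comp_scalar (theta1_derive _) (is_derive_coshprod_coord x j))
  (is_derive_mul (is_derive_coshprod_coord x j)
     (is_derive_sinh_ratio u_gt0 x (delta_mx 0 j) i)))).
by rewrite mxE eqxx/=; ring.
Qed.

Lemma partial2_comp_coshprod i j : partial j (partial i (theta \o W)) =
  (fun x => theta2 (W x) * W x ^+ 2 * (r j x * r i x)
    + theta1 (W x) * W x * (r j x * r i x
       + (i == j)%:R * ((1 + u * cosh (x 0 i)) / (u + cosh (x 0 i)) ^+ 2))).
Proof.
apply/funext => x; rewrite {1}/partial.
by have [_ ->] := is_derive2_comp_coshprod x i j.
Qed.

Lemma C2_comp_coshprod : C2 (theta \o W).
Proof.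
have cW : continuous W by exact: continuous_coshprod.
have cr i : continuous (r i) by exact: continuous_sinh_ratio.
split; first exact: continuous_compW.
- move=> i; split; first by move=> x; have [] := is_derive_comp_coshprod x i.
  rewrite partial_comp_coshprod; apply: continuous_mulf.
    exact: continuous_compW.
  by apply: continuous_mulf; [exact: cW|exact: cr].
- move=> i j; split; first by move=> x; have [] := is_derive2_comp_coshprod x i j.
  rewrite partial2_comp_coshprod.
  have crr : continuous (fun x => r j x * r i x).
    by apply: continuous_mulf; exact: cr.
  apply: continuous_addf.
    apply: continuous_mulf; last exact: crr.
    apply: continuous_mulf; first exact: continuous_compW.
    by apply: continuous_mulf; exact: cW.
  apply: continuous_mulf.
    by apply: continuous_mulf; [exact: continuous_compW|exact: cW].
  apply: continuous_addf; first exact: crr.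
  apply: continuous_mulf; first exact: continuous_const.
  under eq_fun do rewrite -exprVn.
  apply: continuous_mulf.
    apply: continuous_addf; first exact: continuous_const.
    by apply: continuous_mulf; [exact: continuous_const|exact: continuous_cosh_coord].
  by apply: continuous_mulf; exact: continuous_recip.
Qed.

Lemma invariant_comp_coshprod : hyperoctahedral_invariant (theta \o W).
Proof.
move=> s eps x /=; congr theta; rewrite /coshprod [RHS](reindex_perm s).
apply: eq_bigr => i _; rewrite mxE; case: (eps i) => /=.
  by rewrite expr1 mulN1r coshN.
by rewrite expr0 mul1r.
Qed.

(* The continuous extension to all of space of the generator applied to
   [theta \o coshprod u]; the drift is singular only at the walls. *)
Definition gen_comp_coshprod (p q kappa : R) (x : 'rV[R]_N) : R :=
  theta1 (W x) * gen_coshprod u p q x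
  + kappa^-1 * (theta2 (W x) * W x ^+ 2 * \sum_i r i x ^+ 2).

Lemma continuous_gen_comp_coshprod p q kappa :
  continuous (gen_comp_coshprod p q kappa).
Proof.
have cr i : continuous (r i) by exact: continuous_sinh_ratio.
apply: continuous_addf; apply: continuous_mulf.
- exact: continuous_compW.
- exact: continuous_gen_coshprod.
- exact: continuous_const.
apply: continuous_mulf.
  apply: continuous_mulf; first exact: continuous_compW.
  by apply: continuous_mulf; exact: continuous_coshprod.
apply: continuous_big => [|i _]; first exact: add_continuous.
by apply: continuous_mulf; exact: cr.
Qed.

(** This is L(theta(W)) = theta'(W) L W + theta''(W) |grad W|^2 / kappa, with |grad W|^2 equal to
    W^2 times the sum of the squared [sinh_ratio]. It is stated in the interior, where the arguments
    of [coth] are nonzero and the cancellations are valid. *)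
Lemma generator_comp_coshprod p q kappa x : 0 < kappa -> (weylB R N)° x ->
  generator p q kappa (theta \o W) x = gen_comp_coshprod p q kappa x.
Proof.
move=> kappa0 Wx; rewrite /generator /gen_comp_coshprod.
have -> : \sum_(i < N) partial i (partial i (theta \o W)) x
    = theta2 (W x) * W x ^+ 2 * \sum_i r i x ^+ 2
      + theta1 (W x) * W x * (N%:R - u * recip_sum u x).
  rewrite -[in N%:R](card_ord N) -sumr_const /recip_sum !mulr_sumr -sumrB.
  rewrite mulr_sumr -big_split/=; apply: eq_bigr => i _.
  rewrite partial2_comp_coshprod eqxx mul1r -expr2; congr (_ + _ * _).
  rewrite /sinh_ratio; have := gt_eqF (add_cosh_gt0 (x 0 i) u_gt0).
  have := cosh_sinhE (x 0 i).
  move: (cosh _) (sinh _) => c s cs /negbT c0.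
  (* Writing 1 as c^2 - s^2 turns the numerator into c (u + c), so the quotient is 1 - u / (u +
     c). *)
  transitivity ((s ^+ 2 + (c ^+ 2 - s ^+ 2) + u * c) / (u + c) ^+ 2).
    by rewrite cs; field.
  by field.
have -> : \sum_(i < N) drift (q - p) (k02 N p kappa) x i
      * partial i (theta \o W) x
    = theta1 (W x) * W x
      * \sum_(i < N) drift (q - p) (k02 N p kappa) x i * r i x.
  rewrite mulr_sumr; apply: eq_bigr => i _.
  by rewrite partial_comp_coshprod/=; ring.
rewrite (drift_sinh_ratio_sum _ _ u_gt0 Wx) /gen_coshprod /k02.
by field; rewrite gt_eqF.
Qed.

End GeneratorComposition.

(** * Cutoff functions *)

(* [m / 3 - cutoff m v] is concave in [v] and increases to [v] with [m], while
   [cutoff m v] vanishes for [m <= v]. *)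
Section Cutoff.
Context {R : realType}.
Implicit Types m v : R.

Definition cutoff m v : R := m / 3 * Num.max 0 (1 - v / m) ^+ 3.
Definition dcutoff m v : R := - Num.max 0 (1 - v / m) ^+ 2.
Definition ddcutoff m v : R := 2 / m * Num.max 0 (1 - v / m).

Let is_derive_affine m v : is_derive v 1 (fun y : R => 1 - y / m) (- m^-1).
Proof.
under eq_fun do rewrite -mulrN.
apply: (is_derive_val (is_derive_add (is_derive_cst (1 : R) v 1)
  (is_derive_mul (is_derive_id v 1) (is_derive_cst (- m^-1) v 1)))).
by rewrite mulr0 addr0 mul1r add0r.
Qed.

Lemma is_derive_cutoff m v : 0 < m -> is_derive v 1 (cutoff m) (dcutoff m v).
Proof.
move=> m0.
have cube (y : R) : is_derive y 1 (fun z => m / 3 * Num.max 0 z ^+ 3)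
    (m * Num.max 0 y ^+ 2).
  (* The cube of the positive part of z is z times its square, so the derivative of the square
     suffices. *)
  have -> : (fun z => m / 3 * Num.max 0 z ^+ 3)
      = (fun z : R => m / 3 * (z * Num.max 0 z ^+ 2)).
    apply/funext => z; congr (_ * _); rewrite exprS.
    by case: ltP => // z0; rewrite expr0n !mulr0.
  apply: (is_derive_val (is_derive_mul (is_derive_cst (m / 3) _ _)
    (is_derive_mul (is_derive_id y 1) (is_derive_sqr_pos y)))).
  rewrite mul0r add0r; case: ltP => y0; first by rewrite /cst; field.
  by rewrite !expr0n !mulr0 addr0 !mulr0.
apply: (is_derive_val (is_derive_comp_scalar
  (f := fun y : R => 1 - y / m) (cube (1 - v / m)) (is_derive_affine m v))).
by rewrite /dcutoff; field; rewrite gt_eqF.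
Qed.

Lemma is_derive_dcutoff m v : is_derive v 1 (dcutoff m) (ddcutoff m v).
Proof.
have h := is_derive_comp_scalar (f := fun y : R => 1 - y / m)
  (is_derive_sqr_pos (1 - v / m)) (is_derive_affine m v).
apply: (is_derive_val (is_deriveN h)).
by rewrite /ddcutoff; ring.
Qed.

Lemma continuous_ddcutoff m : continuous (ddcutoff m).
Proof.
apply: continuous_mulf; first exact: continuous_const.
move=> v; apply: (@continuous_max R R (cst 0) (fun v => 1 - v / m)).
  exact: cvg_cst.
apply: differentiable_continuous; apply/derivable1_diffP.
by have [] := is_derive_affine m v.
Qed.

Let rescale m v : 0 < m -> 0 <= v -> exists2 w, 0 <= w & v = m * w.
Proof.
move=> m0 v0; exists (v / m); first by rewrite divr_ge0// ltW.
by rewrite mulrC divfK// gt_eqF.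
Qed.

Let rescaleK m w : 0 < m -> 1 - m * w / m = 1 - w.
Proof. by move=> m0; rewrite [m * w]mulrC mulfK// gt_eqF. Qed.

Lemma cutoff_bound m v : 0 < m -> 0 <= v -> 0 <= cutoff m v <= m / 3.
Proof.
move=> m0 v0.
have /andP[s0 s1] : 0 <= Num.max 0 (1 - v / m) <= 1.
  by rewrite le_max lexx/= ge_max ler01/= gerBl divr_ge0// ltW.
have m3 : 0 <= m / 3 by rewrite divr_ge0// ltW.
rewrite /cutoff mulr_ge0 ?exprn_ge0//= -[leRHS]mulr1 ler_wpM2l//.
by rewrite exprn_ile1.
Qed.

Lemma cutoff_gap_le m v : 0 < m -> 0 <= v -> m / 3 - cutoff m v <= v.
Proof.
move=> m0 /(rescale m0)[w w0 ->]; rewrite /cutoff rescaleK//.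
case: (leP 0 (1 - w)) => w1; last by rewrite expr0n/= mulr0 subr0; nra.
rewrite -subr_ge0.
have -> : m * w - (m / 3 - m / 3 * (1 - w) ^+ 3) = m * w ^+ 2 * (1 - w / 3) by field.
by apply: mulr_ge0; [apply: mulr_ge0; [exact: ltW|exact: sqr_ge0]|lra].
Qed.

(** For a concave phi with phi(0) = 0 one has v phi'(v) <= phi(v); here phi(v) = m / 3 -
    [cutoff m v]. It bounds the drift term by the gap itself, which closes the Gronwall inequality
    for each m. *)
Lemma dcutoff_gap_le m v : 0 < m -> 0 <= v ->
  - dcutoff m v * v <= m / 3 - cutoff m v.
Proof.
move=> m0 /(rescale m0)[w w0 ->]; rewrite /cutoff /dcutoff rescaleK// opprK.
case: (leP 0 (1 - w)) => w1; last by rewrite !expr0n mulr0 subr0 mul0r; lra.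
rewrite -subr_ge0.
have -> : m / 3 - m / 3 * (1 - w) ^+ 3 - (1 - w) ^+ 2 * (m * w)
  = m * w ^+ 2 * (1 - 2 * w / 3) by field.
by apply: mulr_ge0; [apply: mulr_ge0; [exact: ltW|exact: sqr_ge0]|lra].
Qed.

Lemma dcutoff_bound m v : 0 < m -> 0 <= v -> -1 <= dcutoff m v <= 0.
Proof.
move=> m0 /(rescale m0)[w w0 ->]; rewrite /dcutoff rescaleK// lerN2 oppr_le0.
by rewrite sqr_ge0 andbT; case: (leP 0 (1 - w)) => w1;
  [rewrite exprn_ile1//; lra|rewrite expr0n].
Qed.

Lemma ddcutoff_bound m v : 0 < m -> 0 <= v ->
  0 <= ddcutoff m v * v ^+ 2 <= 2 * v.
Proof.
move=> m0 /(rescale m0)[w w0 ->]; rewrite /ddcutoff rescaleK//.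
case: (leP 0 (1 - w)) => w1; last by rewrite mulr0 mul0r lexx/= !mulr_ge0// ltW.
have -> : 2 / m * (1 - w) * (m * w) ^+ 2 = 2 * m * (1 - w) * w ^+ 2.
  by field; rewrite gt_eqF.
apply/andP; split; first by rewrite !mulr_ge0 ?sqr_ge0 ?(ltW m0).
rewrite -subr_ge0.
have -> : 2 * (m * w) - 2 * m * (1 - w) * w ^+ 2
  = 2 * m * w * ((1 - w) + w ^+ 2) by ring.
by apply: mulr_ge0; [rewrite !mulr_ge0 ?(ltW m0)|rewrite addr_ge0 ?sqr_ge0].
Qed.

Lemma cutoff_supp m v : 0 < m -> cutoff m v != 0 -> v <= m.
Proof.
move=> m0; apply: contraNT; rewrite -ltNge => mv.
rewrite /cutoff max_l ?expr0n ?mulr0//.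
by rewrite subr_le0 ler_pdivlMr// mul1r ltW.
Qed.

(** The left side is the second-order Taylor polynomial of the gap at 0; the remainder is v^3 / (3
    m^2) up to v = m. *)
Lemma cutoff_gap_ge m v : 0 < m -> 0 <= v ->
  v - v ^+ 2 / m <= m / 3 - cutoff m v.
Proof.
move=> m0 /(rescale m0)[w w0 ->]; rewrite /cutoff rescaleK//.
have -> : (m * w) ^+ 2 / m = m * w ^+ 2 by field; rewrite gt_eqF.
case: (leP 0 (1 - w)) => w1; last first.
  rewrite expr0n/= mulr0 subr0.
  have : 0 <= m * w * (w - 1) by rewrite !mulr_ge0 ?(ltW m0)//; lra.
  by lra.
rewrite -subr_ge0.
have -> : m / 3 - m / 3 * (1 - w) ^+ 3 - (m * w - m * w ^+ 2) = m * w ^+ 3 / 3.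
  by field.
by rewrite divr_ge0// mulr_ge0 ?exprn_ge0// ltW.
Qed.

Lemma dcutoff_le m v : 0 < m -> 0 <= v -> dcutoff m v <= -1 + 2 * v / m.
Proof.
move=> m0 /(rescale m0)[w w0 ->]; rewrite /dcutoff rescaleK//.
have -> : 2 * (m * w) / m = 2 * w by field; rewrite gt_eqF.
case: (leP 0 (1 - w)) => w1; last by rewrite expr0n/=; lra.
by have := sqr_ge0 w; nra.
Qed.

Lemma ddcutoff_le m v : 0 < m -> 0 <= v -> ddcutoff m v <= 2 / m.
Proof.
move=> m0 v0; rewrite /ddcutoff -[leRHS]mulr1 ler_wpM2l ?divr_ge0 ?(ltW m0)//.
by rewrite ge_max ler01/= gerBl divr_ge0// ltW.
Qed.

Lemma cvg_div_succ (c : R) : c / n.+1%:R @[n --> \oo] --> (0 : R).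
Proof.
rewrite -[X in _ --> X](mulr0 c).
by apply: cvgM; [exact: cvg_cst|exact: cvg_harmonic].
Qed.

Lemma cvg_cutoff_gap v : 0 <= v ->
  (n.+1%:R / 3 - cutoff n.+1%:R v) @[n --> \oo] --> v.
Proof.
move=> v0; apply: (@squeeze_cvgr _ _ _ _ (fun n => v - v ^+ 2 / n.+1%:R) (cst v)).
- by near=> n; rewrite cutoff_gap_ge ?cutoff_gap_le.
- rewrite -[X in _ --> X]subr0.
  by apply: cvgB; [exact: cvg_cst|exact: cvg_div_succ].
- exact: cvg_cst.
Unshelve. all: by end_near. Qed.

Lemma cvg_dcutoff v : 0 <= v -> dcutoff n.+1%:R v @[n --> \oo] --> (-1 : R).
Proof.
move=> v0; apply: (@squeeze_cvgr _ _ _ _ (cst (-1)) (fun n => -1 + 2 * v / n.+1%:R)).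
- near=> n; rewrite dcutoff_le// andbT.
  by have /andP[] := @dcutoff_bound n.+1%:R v (ltr0Sn _ _) v0.
- exact: cvg_cst.
- rewrite -[X in _ --> X]addr0.
  by apply: cvgD; [exact: cvg_cst|exact: cvg_div_succ].
Unshelve. all: by end_near. Qed.

Lemma cvg_ddcutoff v : 0 <= v -> ddcutoff n.+1%:R v @[n --> \oo] --> (0 : R).
Proof.
move=> v0; apply: (@squeeze_cvgr _ _ _ _ (cst 0) (fun n => 2 / n.+1%:R)).
- near=> n; rewrite ddcutoff_le// andbT.
  by rewrite /ddcutoff mulr_ge0// ?divr_ge0// le_max lexx.
- exact: cvg_cst.
- exact: cvg_div_succ.
Unshelve. all: by end_near. Qed.

End Cutoff.

Lemma compactly_supported_cutoff {R : realType} {N : nat} (u m : R) :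
  0 < u -> 0 < m -> compactly_supported (cutoff m \o @coshprod R N u).
Proof.
move=> u0 m0; apply: bounded_closed_compact; last exact: closed_closure.
(* On the support, |x_i| <= 2 cosh x_i <= 2 W <= 2 m. *)
exists (2 * m); split; first exact: num_real.
move=> M mM x xA; apply: (le_trans _ (ltW mM)).
have Wm : coshprod u x <= m.
  suff : closure [set y : 'rV[R]_N | cutoff m (coshprod u y) != 0]
      `<=` [set y | coshprod u y <= m] by apply.
  have /closure_id -> : closed [set y : 'rV[R]_N | coshprod u y <= m].
    apply: (@closed_comp _ _ (@coshprod R N u) [set z | z <= m]).
      by move=> y _; exact: continuous_coshprod.
    exact: closed_le.
  by apply: closure_subset => y /=; exact: cutoff_supp.
rewrite /Num.norm/= mx_normrE; apply: bigmax_le => [|[i j] _ /=].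
  by rewrite mulr_ge0// ltW.
rewrite ord1 (le_trans (ler_norm_cosh _))// ler_wpM2l//.
exact: le_trans (cosh_le_coshprod u0 _ _) Wm.
Qed.

(** * The Dynkin formula *)

(** Paths are continuous only on nonnegative times; freezing negative times at 0 gives functions
    continuous on the whole line, to which two-sided results apply. *)
Lemma continuous_clamp {R : realType} {U : topologicalType} (h : R -> U) :
  {within [set t : R | 0 <= t], continuous h} ->
  continuous (fun t : R => h (Num.max 0 t)).
Proof.
move=> /subspace_continuousP hc t A.
have m0 : 0 <= Num.max 0 t by rewrite le_max lexx.
move=> /(hc _ m0) hA.
have ct : {for t, continuous (fun y : R => Num.max 0 y)}.
  by apply: (@continuous_max R R (cst 0) id); [exact: cvg_cst|exact: cvg_id].
have {}hA := ct _ hA.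
apply: (@filterS _ (nbhs t) _ _ _ _ hA) => s /=.
by apply; rewrite le_max lexx.
Qed.

(** * Expectations of bounded processes as functions of time *)

Section BoundedProcess.
Context {R : realType} {d : measure_display} {T : measurableType d}
  (P : probability T R).

Let P_setT : (P : {measure set T -> \bar R}) setT = 1%E.
Proof. exact: probability_setT. Qed.

Let P_setT_lty : ((P : {measure set T -> \bar R}) setT < +oo)%E.
Proof. by rewrite P_setT ltry. Qed.

Lemma bounded_integrable (h : T -> R) (K : R) :
  measurable_fun setT h -> (forall w, `|h w| <= K) ->
  P.-integrable setT (EFin \o h).
Proof.
move=> mh hK; apply: measurable_bounded_integrable => //.
exists K; split; first exact: num_real.
by move=> x Kx y _ /=; rewrite (le_trans (hK y))// ltW.
Qed.

Lemma integrable_const (K : R) : P.-integrable setT (EFin \o (fun _ : T => K)).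
Proof.
by apply: (@bounded_integrable _ `|K|); first exact: measurable_cst.
Qed.

Lemma expectation_const (c : R) : \int[P]_w (fun _ : T => c) w = c.
Proof. by rewrite Rintegral_cst// P_setT/= mulr1. Qed.

Lemma expectation_ae_const (h : T -> R) (c : R) :
  measurable_fun setT h -> {ae P, forall w, h w = c} -> \int[P]_w h w = c.
Proof.
move=> mh hc; rewrite -[RHS](expectation_const c).
rewrite /Rintegral; congr fine; apply: ae_eq_integral.
- exact: measurableT.
- exact/measurable_EFinP.
- exact/measurable_EFinP/measurable_cst.
- by apply: filterS hc => w /= ->.
Qed.

Variables (g : R -> T -> R) (K : R).
Hypothesis g_meas : forall t, 0 <= t -> measurable_fun setT (g t).
Hypothesis g_bnd : forall t w, `|g t w| <= K.
Hypothesis g_cont : forall w, {within [set t : R | 0 <= t], continuous (g ^~ w)}.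

Let K_ge0 : 0 <= K.
Proof.
exact: le_trans (normr_ge0 _) (g_bnd 0 point).
Qed.

Lemma expectation_clamp_continuous :
  continuous (fun t : R => \int[P]_w g (Num.max 0 t) w).
Proof.
move=> t.
have mg s : measurable_fun setT (g (Num.max 0 s)) by apply: g_meas; rewrite le_max lexx.
have := @continuity_under_integral R d T P (fun s w => g (Num.max 0 s) w) setT
  measurableT (t - 1) (t + 1).
apply.
- by move=> s _; exact: bounded_integrable (mg s) (g_bnd _).
- by apply: aeW => w _ s _; exact: (@continuous_clamp R R (g ^~ w)).
- exact: (integrable_const K).
- by move=> s _; apply: aeW => w _; exact: g_bnd.
- by rewrite inE/= in_itv/=; apply/andP; split; lra.
Qed.

Let G t w : R := \int[lebesgue_measure]_(s in `[0, t]) g s w.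

Lemma derive_time_integral w (t : R) : 0 < t ->
  derivable (G ^~ w) t 1 /\ (G ^~ w)^`()%classic t = g t w.
Proof.
move=> t0.
have tt1 : t < t + 1 by rewrite ltrDl.
have cg : {within `[0, t + 1], continuous (g ^~ w)}.
  have := @g_cont w; apply: continuous_subspaceW => s /=.
  by rewrite in_itv/= => /andP[].
apply: (@continuous_FTC1 R (g ^~ w) (BLeft 0) t (t + 1)) => //.
- by apply: continuous_compact_integrable; [exact: segment_compact|exact: cg].
- apply: (within_continuous_continuous _ cg); first by rewrite addr_gt0.
  by rewrite in_itv/= t0.
Qed.

Hypothesis G_int : forall t, 0 <= t -> P.-integrable setT (EFin \o G t).

(** Differentiating under the expectation takes the place of Fubini's theorem, which would call for
    joint measurability in time and sample point. *)
Lemma is_derive_expectation_time_integral (t : R) : 0 < t ->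
  is_derive t 1 (fun t : R => \int[P]_w G t w) (\int[P]_w g t w).
Proof.
move=> t0.
have It : `]0, t + 1[%classic t by rewrite /= in_itv/= t0 ltrDl ltr01.
have I0 s : `]0, t + 1[%classic s -> 0 < s by rewrite /= in_itv/= => /andP[].
have dG s w : `]0, t + 1[%classic s -> partial1of2 G s w = g s w.
  by move=> /I0 s0; rewrite /partial1of2; have [_ ->] := derive_time_integral w s0.
have := @cvg_differentiation_under_integral R d T P G setT measurableT t 0 (t + 1) It
  (fun s Is => G_int (ltW (I0 s Is))) (fun s w Is _ => (derive_time_integral w (I0 s Is)).1)
  (fun=> K) (fun=> K_ge0) (integrable_const K).
have GK : forall s w, `]0, t + 1[%classic s -> setT w -> `|partial1of2 G s w| <= K.
  by move=> s w Is _; rewrite dG.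
move=> /(_ GK).
have -> : \int[P]_y partial1of2 G t y = \int[P]_y g t y.
  by apply: eq_Rintegral => w _; exact: dG.
move=> lim; split.
  apply/cvg_ex; exists (\int[P]_y g t y).
  by under eq_fun do rewrite scaler1.
rewrite /derive; under eq_fun do rewrite scaler1.
exact: (cvg_lim (@Rhausdorff R) lim).
Qed.

End BoundedProcess.

(** * Measurability of functions of the coordinates *)

Section Measurability.
Context {R : realType} {N : nat} {d : measure_display} {T : measurableType d}.
Variables (u : R) (u_gt0 : 0 < u) (Z : T -> 'rV[R]_N).
Hypothesis Z_meas : forall i, measurable_fun setT (fun w => Z w 0 i).

(** Measurability is given coordinate by coordinate, so the functions of this section are rebuilt
    from one-variable continuous functions by sums and products. *)
Lemma measurable_continuous_coord (h : R -> R) (i : 'I_N) : continuous h ->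
  measurable_fun setT (fun w => h (Z w 0 i)).
Proof.
move=> ch; apply: (@measurableT_comp _ _ _ _ _ _ h) => //.
exact: continuous_measurable_fun.
Qed.

Lemma measurable_cosh_coord i : measurable_fun setT (fun w => cosh (Z w 0 i)).
Proof. by apply: measurable_continuous_coord; exact: continuous_cosh. Qed.

Lemma measurable_coshprod : measurable_fun setT (fun w => coshprod u (Z w)).
Proof.
apply: measurable_prod => i _; apply: measurable_funD.
  exact: measurable_cst.
exact: measurable_cosh_coord.
Qed.

Lemma measurable_recip i : measurable_fun setT (fun w => (u + cosh (Z w 0 i))^-1).
Proof.
apply: (measurable_continuous_coord (h := fun y => (u + cosh y)^-1)).
apply: continuous_invf => [y|]; first by rewrite gt_eqF// add_cosh_gt0.
by apply: continuous_addf; [exact: continuous_const|exact: continuous_cosh].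
Qed.

Lemma measurable_recip_sum : measurable_fun setT (fun w => recip_sum u (Z w)).
Proof. by apply: measurable_sum => i; exact: measurable_recip. Qed.

Lemma measurable_recip_sqr_sum :
  measurable_fun setT (fun w => recip_sqr_sum u (Z w)).
Proof.
by apply: measurable_sum => i; apply: measurable_funX; exact: measurable_recip.
Qed.

Lemma measurable_sinh_ratio i : measurable_fun setT (fun w => sinh_ratio u i (Z w)).
Proof.
apply: measurable_funM; last exact: measurable_recip.
by apply: measurable_continuous_coord; exact: continuous_sinh.
Qed.

Lemma measurable_gen_coshprod p q :
  measurable_fun setT (fun w => gen_coshprod u p q (Z w)).
Proof.
have mS := measurable_recip_sum; have mS2 := measurable_recip_sqr_sum.
have mc (c : R) : measurable_fun setT (fun _ : T => c) by exact: measurable_cst.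
have mcS (c : R) : measurable_fun setT (fun w : T => c * recip_sum u (Z w)).
  exact: measurable_funM (mc c) mS.
apply: measurable_funM; first exact: measurable_coshprod.
apply: measurable_funD.
  apply: measurable_funD (mc _).
  apply: measurable_funD; apply: measurable_funM (mc _) _.
    exact: measurable_funD (mc _) (mcS _).
  exact: measurable_funB (mc _) (mcS _).
apply: measurable_funM (mc _) _.
by apply: measurable_funB mS2; exact: measurable_funX.
Qed.

Lemma measurable_gen_comp_coshprod (theta1 theta2 : R -> R) p q kappa :
  measurable_fun setT theta1 -> measurable_fun setT theta2 ->
  measurable_fun setT (fun w => gen_comp_coshprod u theta1 theta2 p q kappa (Z w)).
Proof.
move=> m1 m2; apply: measurable_funD; apply: measurable_funM.
- by apply: (@measurableT_comp _ _ _ _ _ _ theta1) => //; exact: measurable_coshprod.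
- exact: measurable_gen_coshprod.
- exact: measurable_cst.
apply: measurable_funM.
  apply: measurable_funM.
    by apply: (@measurableT_comp _ _ _ _ _ _ theta2) => //; exact: measurable_coshprod.
  by apply: measurable_funX; exact: measurable_coshprod.
by apply: measurable_sum => i; apply: measurable_funX; exact: measurable_sinh_ratio.
Qed.

End Measurability.

(** * Estimates for the generator on the cutoffs *)

Section CutoffGenerator.
Context {R : realType} {N : nat} (u : R) (u_gt0 : 0 < u) (p q kappa : R).
Hypothesis kappa_gt0 : 0 < kappa.

Definition gen_cutoff (m : R) : 'rV[R]_N -> R :=
  gen_comp_coshprod u (dcutoff m) (ddcutoff m) p q kappa.

(** The first bound feeds Gronwall's lemma: it is one-sided because the second-order term has a
    sign, by concavity, and is dropped. The second gives boundedness for fixed m, the third a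
    domination uniform in m. *)
Lemma gen_cutoff_bounds : exists2 C : R, 0 <= C &
  forall m x, 0 < m ->
  [/\ - gen_cutoff m x <= C * (m / 3 - cutoff m (coshprod u x)),
      `|gen_cutoff m x| <= C * m &
      `|gen_cutoff m x| <= C * coshprod u x].
Proof.
have [C C0 hC] := @gen_coshprod_bound R N u u_gt0 p q.
(* The 2 comes from [ddcutoff_bound] and N from the sum of N squared ratios, each at most 1. *)
exists (C + kappa^-1 * (2 * N%:R)) => [|m x m0].
  by rewrite addr_ge0// mulr_ge0// ?mulr_ge0// invr_ge0 ltW.
rewrite /gen_cutoff /gen_comp_coshprod.
have W0 := ltW (coshprod_gt0 u_gt0 x).
have /andP[d1 d0] := dcutoff_bound m0 W0.
have /andP[e0 e1] := ddcutoff_bound m0 W0.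
have dg := dcutoff_gap_le m0 W0.
have /andP[Q0 QN] := sum_sqr_sinh_ratio_le u_gt0 x.
have {hC} := hC x; move: (gen_coshprod _ _ _ _) (\sum_i _) Q0 QN => L Q Q0 QN.
have e2 : ddcutoff m (coshprod u x) * coshprod u x ^+ 2 <= 2 * m.
  have [Wm|mW] := leP (coshprod u x) m; first by rewrite (le_trans e1)// ler_wpM2l.
  rewrite /ddcutoff max_l ?mulr0 ?mul0r ?mulr_ge0 ?ltW//.
  by rewrite subr_lt0 ltr_pdivlMr// mul1r.
have /andP[c0 c3] := cutoff_bound m0 W0.
move: (coshprod _ _) W0 d1 d0 e0 e1 e2 dg c0 c3 => W W0.
move: (dcutoff _ _) (ddcutoff _ _ * _) (cutoff _ _) => D1 D2 c.
move=> d1 d0 e0 e1 e2 dg c0 c3 LW.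
have k0 : 0 <= kappa^-1 by rewrite invr_ge0 ltW.
have D1L : `|D1 * L| <= C * (- D1 * W).
  rewrite normrM ler0_norm//.
  by rewrite mulrCA ler_wpM2l// oppr_ge0.
have DQ0 : 0 <= kappa^-1 * (D2 * Q) by rewrite !mulr_ge0.
have DQ B : 0 <= B -> D2 <= 2 * B -> kappa^-1 * (D2 * Q) <= kappa^-1 * (2 * N%:R) * B.
  move=> B0 D2B; rewrite -mulrA ler_wpM2l// mulrAC.
  by rewrite ler_pM.
have CW B : - D1 * W <= B -> C * (- D1 * W) <= C * B by move=> ?; rewrite ler_wpM2l.
split.
- have := CW _ dg; have : 0 <= kappa^-1 * (2 * N%:R) * (m / 3 - c).
    by rewrite !mulr_ge0// subr_ge0.
  by move: D1L; rewrite ler_norml => /andP[]; lra.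
- rewrite (le_trans (ler_normD _ _))// mulrDl lerD//; last first.
    by rewrite ger0_norm// DQ// ltW.
  by rewrite (le_trans D1L)// CW// (le_trans dg)//; lra.
- rewrite (le_trans (ler_normD _ _))// mulrDl lerD//; last first.
    by rewrite ger0_norm// DQ.
  by rewrite (le_trans D1L)// CW//; nra.
Qed.

End CutoffGenerator.

(** The mean value theorem for a(s) exp(- C s) gives the claim directly from the differential
    inequality, for C of either sign and without integrating a'. *)
Lemma gronwall_derive {R : realType} (a a' : R -> R) (C t : R) :
  (forall s : R, 0 < s -> is_derive s 1 a (a' s)) ->
  (forall s : R, 0 < s -> a' s <= C * a s) ->
  {within `[0, t], continuous a} -> 0 <= t -> a t <= a 0 * expR (C * t).
Proof.
move=> da a'C ca; rewrite le_eqVlt => /predU1P[<-|t0].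
  by rewrite mulr0 expR0 mulr1.
have dE (s : R) : is_derive s 1 (fun y : R => expR (- C * y)) (- C * expR (- C * s)).
  apply: (is_derive_val (is_derive1_comp (is_derive_expR _)
    (is_derive_mul (is_derive_cst (- C) s 1) (is_derive_id s 1)))).
  by rewrite mul0r add0r mulr1 mulrC.
have cE : continuous (fun y : R => expR (- C * y)).
  by move=> s; apply: differentiable_continuous; apply/derivable1_diffP; have [] := dE s.
pose F s := a s * expR (- C * s).
have dF (s : R) : s \in `]0, t[ -> is_derive s 1 F
    (a' s * expR (- C * s) + a s * (- C * expR (- C * s))).
  rewrite in_itv/= => /andP[s0 _]; exact: is_derive_mul (da _ s0) (dE s).
have cF : {within `[0, t], continuous F}.
  by move=> s; apply: cvgM; [exact: ca|exact: continuous_subspaceT].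
have [s] := MVT t0 dF cF.
rewrite in_itv/= => /andP[s0 _] FE.
have : F t <= F 0.
  rewrite -subr_le0 FE subr0 mulr_le0_ge0 ?(ltW t0)//.
  have -> : a' s * expR (- C * s) + a s * (- C * expR (- C * s))
    = expR (- C * s) * (a' s - C * a s) by ring.
  by rewrite mulr_ge0_le0 ?expR_ge0// subr_le0 a'C.
rewrite /F mulr0 expR0 mulr1 mulNr expRN => /(ler_wpM2r (expR_ge0 (C * t))).
by rewrite mulfVK// gt_eqF// expR_gt0.
Qed.

(** * Dynkin's formula for the cutoffs *)

Section DiffusionMoments.
Context {R : realType} {N : nat} {d : measure_display} {T : measurableType d}.
Variables (P : probability T R) (p q kappa : R) (x : 'rV[R]_N) (X : R -> T -> 'rV[R]_N).
Hypothesis kappa_gt0 : 0 < kappa.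
Hypothesis hX : is_diffusion P p q kappa x X.

Lemma diffusion_measurable (t : R) : 0 <= t ->
  forall i, measurable_fun setT (fun w => X t w 0 i).
Proof. by case: hX => + _ _ _ _ t0; apply. Qed.

Let path_cont (h : 'rV[R]_N -> R) w : continuous h ->
  {within [set t : R | 0 <= t], continuous (fun t => h (X t w))}.
Proof.
case: hX => _ _ cX _ _ ch s.
exact: (cvg_comp _ h (@cX w s) (ch _)).
Qed.

Section FixedParameter.
Variables (u : R) (u_gt0 : 0 < u).

Local Notation W := (@coshprod R N u).
Local Notation Lm := (@gen_cutoff R N u p q kappa).

Lemma measurable_cutoff_process (m t : R) : 0 < m -> 0 <= t ->
  measurable_fun setT (fun w => cutoff m (W (X t w))).
Proof.
move=> m0 t0; apply: (@measurableT_comp _ _ _ _ _ _ (cutoff m)).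
  apply: continuous_measurable_fun => v.
  apply: differentiable_continuous; apply/derivable1_diffP.
  by have [] := is_derive_cutoff v m0.
by apply: measurable_coshprod => //; exact: diffusion_measurable.
Qed.

Lemma continuous_cutoff_coshprod (m : R) : 0 < m ->
  continuous (cutoff m \o W).
Proof.
move=> m0.
have [] := @C2_comp_coshprod R N u u_gt0 (cutoff m) (dcutoff m) (ddcutoff m)
  (fun v => is_derive_cutoff v m0) (is_derive_dcutoff m) (@continuous_ddcutoff R m).
by [].
Qed.

Lemma continuous_gen_cutoff (m : R) : 0 < m -> continuous (Lm m).
Proof.
move=> m0; apply: continuous_gen_comp_coshprod => //.
- by move=> v; exact: is_derive_dcutoff.
- exact: continuous_ddcutoff.
Qed.

Lemma measurable_gen_cutoff (m t : R) : 0 < m -> 0 <= t ->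
  measurable_fun setT (fun w => Lm m (X t w)).
Proof.
move=> m0 t0; apply: measurable_gen_comp_coshprod => //; first exact: diffusion_measurable.
  apply: continuous_measurable_fun => v.
  apply: differentiable_continuous; apply/derivable1_diffP.
  by have [] := is_derive_dcutoff m v.
by apply: continuous_measurable_fun; exact: continuous_ddcutoff.
Qed.

Lemma cutoff_martingale (m : R) : 0 < m ->
  martingale P (natural_filtration X)
    (fun t w => cutoff m (W (X t w)) - cutoff m (W (X 0 w))
       - \int[lebesgue_measure]_(s in `[0, t]) Lm m (X s w)).
Proof.
move=> m0; case: hX => _ _ _ _ /(_ (cutoff m \o W) (Lm m)); apply.
- apply: (@C2_comp_coshprod R N u u_gt0 _ (dcutoff m) (ddcutoff m)).
  + by move=> v; exact: is_derive_cutoff.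
  + exact: is_derive_dcutoff.
  + exact: continuous_ddcutoff.
- exact: compactly_supported_cutoff.
- exact: invariant_comp_coshprod.
- by apply: continuous_subspaceT; exact: continuous_gen_cutoff.
- move=> z Wz; exact/esym/(@generator_comp_coshprod R N u u_gt0 (cutoff m)
    (dcutoff m) (ddcutoff m) (fun v => is_derive_cutoff v m0)
    (is_derive_dcutoff m) p q kappa z kappa_gt0 Wz).
Qed.

Lemma cutoff_process_bounded (m : R) t w : 0 < m ->
  `|cutoff m (W (X t w))| <= m.
Proof.
move=> m0; have /andP[c0 c1] := cutoff_bound m0 (ltW (coshprod_gt0 u_gt0 (X t w))).
by rewrite ger0_norm//; lra.
Qed.

Lemma integrable_cutoff_process (m t : R) : 0 < m -> 0 <= t ->
  P.-integrable setT (EFin \o (fun w => cutoff m (W (X t w)))).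
Proof.
move=> m0 t0; apply: (@bounded_integrable R d T P _ m).
  exact: measurable_cutoff_process.
by move=> w; exact: cutoff_process_bounded.
Qed.

(** The integral is a difference of bounded terms and the martingale, so it inherits integrability,
    and in particular measurability, from the martingale problem. *)
Lemma integrable_time_integral (m t : R) : 0 < m -> 0 <= t ->
  P.-integrable setT (EFin \o
    (fun w => \int[lebesgue_measure]_(s in `[0, t]) Lm m (X s w))).
Proof.
move=> m0 t0; have [/(_ _ t0) iM _ _] := cutoff_martingale m0.
have ic := integrable_cutoff_process m0 t0.
have ic0 := integrable_cutoff_process m0 (lexx 0).
have := integrableB measurableT (integrableB measurableT ic ic0) iM.
apply: eq_integrable => // w _ /=.
by rewrite -!EFinB; congr EFin; ring.
Qed.

Lemma expectation_cutoffE (m t : R) : 0 < m -> 0 <= t ->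
  \int[P]_w cutoff m (W (X t w)) = \int[P]_w cutoff m (W (X 0 w))
   + \int[P]_w \int[lebesgue_measure]_(s in `[0, t]) Lm m (X s w).
Proof.
move=> m0 t0; have [iM _ /(_ 0 t)] := cutoff_martingale m0.
rewrite lexx t0 => /(_ isT setT) EM.
have {}EM : natural_filtration X 0 [set: T] -> \int[P]_w (cutoff m (W (X t w))
   - cutoff m (W (X 0 w)) - \int[lebesgue_measure]_(s in `[0, t]) Lm m (X s w)) = 0.
  (* At time 0 the martingale vanishes: the time integral runs over a single point. *)
  move=> /EM ->; under eq_Rintegral => w _.
    rewrite set_itv1 Rintegral_set1 subrr subr0.
    over.
  exact: expectation_const.
have FT : natural_filtration X 0 [set: T].
  move=> G [[G0 GC _] _]; rewrite -(setD0 setT); exact: GC.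
move: (EM FT); rewrite RintegralB//; first rewrite RintegralB//.
- by move=> /eqP; rewrite subr_eq0 subr_eq => /eqP ->; rewrite addrC.
- exact: integrable_cutoff_process.
- exact: integrable_cutoff_process.
- have := integrableB measurableT (integrable_cutoff_process m0 t0)
    (integrable_cutoff_process m0 (lexx 0)).
  by apply: eq_integrable.
- exact: integrable_time_integral.
Qed.

Lemma expectation_cutoff_start (m : R) : 0 < m ->
  \int[P]_w cutoff m (W (X 0 w)) = cutoff m (W x).
Proof.
move=> m0; case: hX => _ _ _ X0 _.
apply: expectation_ae_const; first exact: measurable_cutoff_process.
by apply: filterS X0 => w /= ->.
Qed.

Lemma is_derive_expectation_cutoff (m t : R) : 0 < m -> 0 < t ->
  is_derive t 1 (fun t : R => \int[P]_w cutoff m (W (X t w)))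
    (\int[P]_w Lm m (X t w)).
Proof.
move=> m0 t0; have [C C0 hC] := @gen_cutoff_bounds R N u u_gt0 p q kappa kappa_gt0.
have dG := @is_derive_expectation_time_integral R d T P (fun t w => Lm m (X t w)) (C * m)
  (fun s w => let: And3 _ h _ := hC m (X s w) m0 in h)
  (fun w => path_cont (w := w) (continuous_gen_cutoff m0))
  (fun s s0 => integrable_time_integral m0 s0) t t0.
have dcG := is_derive_add (is_derive_cst (\int[P]_w cutoff m (W (X 0 w))) t 1) dG.
have {}dcG := is_derive_val dcG (add0r _).
apply: near_eq_is_derive dcG; near=> s; rewrite /cst/=.
rewrite -expectation_cutoffE// ltW//; near: s; exact: lt_nbhsr.
Unshelve. all: by end_near. Qed.

Lemma expectation_cutoff_continuous (m : R) : 0 < m ->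
  continuous (fun t : R => \int[P]_w cutoff m (W (X (Num.max 0 t) w))).
Proof.
move=> m0; apply: (@expectation_clamp_continuous R d T P
  (fun t w => cutoff m (W (X t w))) m).
- by move=> t t0; exact: measurable_cutoff_process.
- by move=> t w; exact: cutoff_process_bounded.
- by move=> w; exact: (@path_cont _ w (continuous_cutoff_coshprod m0)).
Qed.

Lemma expectation_gen_cutoff_continuous (m : R) : 0 < m ->
  continuous (fun t : R => \int[P]_w Lm m (X (Num.max 0 t) w)).
Proof.
move=> m0; have [C C0 hC] := @gen_cutoff_bounds R N u u_gt0 p q kappa kappa_gt0.
apply: (@expectation_clamp_continuous R d T P (fun t w => Lm m (X t w)) (C * m)).
- by move=> t t0; exact: measurable_gen_cutoff.
- by move=> t w; case: (hC m (X t w) m0).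
- by move=> w; exact: (@path_cont _ w (continuous_gen_cutoff m0)).
Qed.

End FixedParameter.

End DiffusionMoments.

(** * Convergence theorems for real-valued integrals *)

Section IntegralLimits.
Context {d : measure_display} {T : measurableType d} {R : realType}.
Variables (mu : {measure set T -> \bar R}) (D : set T).
Hypothesis mD : measurable D.

Lemma Rintegral_dominated_cvg (h_ : nat -> T -> R) (h G : T -> R) :
  (forall n, measurable_fun D (h_ n)) ->
  (forall w, D w -> h_ n w @[n --> \oo] --> h w) ->
  mu.-integrable D (EFin \o G) ->
  (forall n w, D w -> `|h_ n w| <= G w) ->
  mu.-integrable D (EFin \o h) /\
  \int[mu]_(w in D) h_ n w @[n --> \oo] --> \int[mu]_(w in D) h w.
Proof.
move=> mh_ hh iG hG.
have [|||||ih _ lim] := @dominated_convergence _ _ _ mu D mD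
    (fun n => EFin \o h_ n) (EFin \o h) (EFin \o G).
- by move=> n; exact/measurable_EFinP.
- by apply/measurable_EFinP; exact: measurable_fun_cvg mh_ hh.
- apply: aeW => w Dw; apply: cvg_EFin; last exact: hh.
  by near=> n.
- exact: iG.
- by apply: aeW => w n Dw /=; rewrite lee_fin hG.
have hE : (\int[mu]_(w in D) (EFin \o h) w)%E = (\int[mu]_(w in D) h w)%:E.
  by rewrite /Rintegral fineK//; exact: integrable_fin_num.
by split=> //; move: lim; rewrite hE => /fine_cvg.
Unshelve. all: by end_near. Qed.

Lemma Rintegral_fatou_le (h_ : nat -> T -> R) (h : T -> R) (B : R) :
  (forall n, mu.-integrable D (EFin \o h_ n)) ->
  (forall n w, D w -> 0 <= h_ n w) ->
  (forall w, D w -> h_ n w @[n --> \oo] --> h w) ->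
  (forall n, \int[mu]_(w in D) h_ n w <= B) ->
  mu.-integrable D (EFin \o h) /\ \int[mu]_(w in D) h w <= B.
Proof.
move=> ih_ h0 hh hB.
have mh_ n : measurable_fun D (h_ n).
  by apply/measurable_EFinP; have /integrableP[] := ih_ n.
have mh : measurable_fun D h by exact: measurable_fun_cvg mh_ hh.
have hge0 w : D w -> 0 <= h w.
  move=> Dw; apply: (cvgr_to_ge (hh w Dw)).
  by near=> n; exact: h0.
have leB : (\int[mu]_(w in D) (h w)%:E <= B%:E)%E.
  have -> : (\int[mu]_(w in D) (h w)%:E
      = \int[mu]_(w in D) limn_einf (fun n => (h_ n w)%:E))%E.
    apply: eq_integral => w /[!inE] Dw.
    have lim : ((h_ n w)%:E @[n --> \oo] --> (h w)%:E)%E.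
      by apply: cvg_EFin; [near=> n|exact: hh].
    rewrite is_cvg_limn_einfE; last by apply/cvg_ex; eexists; exact: lim.
    by apply/esym/cvg_lim => //; exact: lim.
  have mE n : measurable_fun D (EFin \o h_ n) by exact/measurable_EFinP.
  have E0 n w : D w -> (0 <= (EFin \o h_ n) w)%E by move=> Dw; rewrite lee_fin h0.
  apply: le_trans (fatou mu mD mE E0) _.
  rewrite limn_einf_lim; apply: lime_le; first exact: is_cvg_einfs.
  near=> n; apply: ereal_inf_le; exists (\int[mu]_(w in D) (h_ n w)%:E)%E.
    by exists n => //=.
  rewrite -(@fineK _ (\int[mu]_(w in D) (h_ n w)%:E)%E) ?integrable_fin_num//.
    by rewrite lee_fin; exact: hB.
  exact: ih_.
have ih : mu.-integrable D (EFin \o h).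
  apply/integrableP; split; first exact/measurable_EFinP.
  apply: le_lt_trans (ltry B); apply: le_trans leB.
  rewrite le_eqVlt; apply/orP; left; apply/eqP; apply: eq_integral => w /[!inE] Dw.
  by rewrite /= ger0_norm// hge0.
split=> //; rewrite -lee_fin /Rintegral fineK//.
exact: (integrable_fin_num mD ih).
Unshelve. all: by end_near. Qed.

End IntegralLimits.

(** * Removal of the cutoff *)

Section DiffusionLimit.
Context {R : realType} {N : nat} {d : measure_display} {T : measurableType d}.
Variables (P : probability T R) (p q kappa : R) (x : 'rV[R]_N) (X : R -> T -> 'rV[R]_N).
Hypothesis kappa_gt0 : 0 < kappa.
Hypothesis hX : is_diffusion P p q kappa x X.
Variables (u : R) (u_gt0 : 0 < u).

Local Notation W := (@coshprod R N u).
Local Notation Lm := (@gen_cutoff R N u p q kappa).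

Let ic (m t : R) (m0 : 0 < m) (t0 : 0 <= t) :=
  @integrable_cutoff_process R N d T P p q kappa x X hX u u_gt0 m t m0 t0.

Let ig (m t : R) : 0 < m -> 0 <= t ->
  P.-integrable setT (EFin \o (fun w => Lm m (X t w))).
Proof.
move=> m0 t0; have [C C0 hC] := @gen_cutoff_bounds R N u u_gt0 p q kappa kappa_gt0.
apply: (@bounded_integrable R d T P _ (C * m)).
  exact: (measurable_gen_cutoff hX u_gt0).
by move=> w; case: (hC m (X t w) m0).
Qed.

Let igap (m t : R) : 0 < m -> 0 <= t ->
  P.-integrable setT (EFin \o (fun w => m / 3 - cutoff m (W (X t w)))).
Proof.
move=> m0 t0.
have := integrableB measurableT (integrable_const P (m / 3)) (ic m0 t0).
by apply: eq_integrable.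
Qed.

Let expectation_gap (m t : R) : 0 < m -> 0 <= t ->
  \int[P]_w (m / 3 - cutoff m (W (X t w)))
  = m / 3 - \int[P]_w cutoff m (W (X t w)).
Proof.
move=> m0 t0; rewrite RintegralB//; last exact: ic.
  by rewrite expectation_const.
exact: integrable_const.
Qed.

(** Gronwall's lemma applies to the expected gap, which starts below W x. What matters is that C is
    chosen before m, so that Fatou's lemma can follow. *)
Lemma cutoff_gap_moment : exists2 C : R, 0 <= C & forall m t : R, 0 < m -> 0 <= t ->
  \int[P]_w (m / 3 - cutoff m (W (X t w))) <= W x * expR (C * t).
Proof.
have [C C0 hC] := @gen_cutoff_bounds R N u u_gt0 p q kappa kappa_gt0.
exists C => // m t m0 t0; rewrite expectation_gap//.
pose a (s : R) := m / 3 - \int[P]_w cutoff m (W (X s w)).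
have a0 : a 0 <= W x.
  rewrite /a (expectation_cutoff_start hX).
    by apply: cutoff_gap_le => //; exact/ltW/coshprod_gt0.
  by [].
apply: (@le_trans _ _ (a 0 * expR (C * t))); last by rewrite ler_wpM2r// expR_ge0.
have hgron := @gronwall_derive R a (fun s => - \int[P]_w Lm m (X s w)) C t.
apply: hgron; last exact: t0.
- move=> s s0; rewrite -[X in is_derive _ _ _ X]add0r.
  exact: is_deriveB (is_derive_cst (m / 3) s 1)
    (is_derive_expectation_cutoff kappa_gt0 hX u_gt0 m0 s0).
- move=> s s0; have s0' := ltW s0; rewrite /a -expectation_gap//.
  rewrite -RintegralZl//; last exact: igap.
  rewrite -[X in - X]mul1r -mulNr -RintegralZl//; last exact: ig.
  apply: le_Rintegral => //.
  + have := integrableZl measurableT (-1) (ig m0 s0').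
    by apply: eq_integrable.
  + have := integrableZl measurableT C (igap m0 s0').
    by apply: eq_integrable.
  + by move=> w _; rewrite mulN1r; case: (hC m (X s w) m0).
- have cb := expectation_cutoff_continuous hX u_gt0 m0.
  apply: (@subspace_eq_continuous _ _ _
    (fun s : R => m / 3 - \int[P]_w cutoff m (W (X (Num.max 0 s) w)))).
    by move=> s; rewrite inE/= in_itv/= => /andP[s0 _]; rewrite /a max_r.
  apply: continuous_subspaceT => s; apply: cvgB; [exact: cvg_cst|exact: cb].
Qed.

Lemma coshprod_moment : exists2 C : R, 0 <= C & forall t : R, 0 <= t ->
  P.-integrable setT (EFin \o (fun w => W (X t w))) /\
  \int[P]_w W (X t w) <= W x * expR (C * t).
Proof.
have [C C0 hC] := cutoff_gap_moment; exists C => // t t0.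
apply: (@Rintegral_fatou_le _ _ _ P setT measurableT
  (fun n w => n.+1%:R / 3 - cutoff n.+1%:R (W (X t w)))).
- by move=> n; exact: igap.
- move=> n w _; rewrite subr_ge0.
  by have /andP[] := @cutoff_bound R n.+1%:R (W (X t w)) (ltr0Sn _ _) (ltW (coshprod_gt0 u_gt0 _)).
- by move=> w _; apply: cvg_cutoff_gap; exact/ltW/coshprod_gt0.
- by move=> n; exact: hC.
Qed.

Let W_ge0 (y : 'rV[R]_N) : 0 <= W y.
Proof. exact/ltW/coshprod_gt0. Qed.

Lemma integrable_coshprod (t : R) : 0 <= t ->
  P.-integrable setT (EFin \o (fun w => W (X t w))).
Proof. by move=> t0; have [C _ /(_ t t0)[]] := coshprod_moment. Qed.

Local Notation ell t := (\int[P]_w gen_coshprod u p q (X t w)).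

Lemma integrable_gen_coshprod (t : R) : 0 <= t ->
  P.-integrable setT (EFin \o (fun w => gen_coshprod u p q (X t w))).
Proof.
move=> t0; have [C C0 hC] := @gen_coshprod_bound R N u u_gt0 p q.
apply: (@le_integrable _ _ _ P setT measurableT _
    (EFin \o (fun w => C * W (X t w)))).
- by apply/measurable_EFinP; apply: measurable_gen_coshprod => //; exact: (diffusion_measurable hX).
- move=> w _ /=; rewrite lee_fin (le_trans (hC _))// ler_norm//.
- have := integrableZl measurableT C (integrable_coshprod t0).
  by apply: eq_integrable.
Qed.

Lemma cvg_expectation_cutoff_gap (t : R) : 0 <= t ->
  \int[P]_w (n.+1%:R / 3 - cutoff n.+1%:R (W (X t w))) @[n --> \oo] -->
  \int[P]_w W (X t w).
Proof.
move=> t0.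
apply: (@Rintegral_dominated_cvg _ _ _ P setT measurableT
  (fun n w => n.+1%:R / 3 - cutoff n.+1%:R (W (X t w))) _ (fun w => W (X t w)) _ _ _ _).2.
- move=> n; apply/measurable_EFinP.
  by have /integrableP[] := @igap n.+1%:R t (ltr0Sn _ _) t0.
- by move=> w _; exact: cvg_cutoff_gap.
- exact: integrable_coshprod.
- move=> n w _; rewrite ger0_norm; first exact: cutoff_gap_le.
  rewrite subr_ge0.
  by have /andP[] := @cutoff_bound R n.+1%:R (W (X t w)) (ltr0Sn _ _) (W_ge0 _).
Qed.

Lemma cvg_expectation_gen_cutoff (t : R) : 0 <= t ->
  \int[P]_w Lm n.+1%:R (X t w) @[n --> \oo] --> - ell t.
Proof.
move=> t0; have [C C0 hC] := @gen_cutoff_bounds R N u u_gt0 p q kappa kappa_gt0.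
have -> : - ell t = \int[P]_w (- gen_coshprod u p q (X t w)).
  rewrite -mulN1r -RintegralZl//; last exact: integrable_gen_coshprod.
  by apply: eq_Rintegral => w _; rewrite mulN1r.
apply: (@Rintegral_dominated_cvg _ _ _ P setT measurableT
  (fun n w => Lm n.+1%:R (X t w)) _ (fun w => C * W (X t w)) _ _ _ _).2.
- by move=> n; exact: (measurable_gen_cutoff hX u_gt0).
- move=> w _; rewrite /gen_cutoff /gen_comp_coshprod.
  set L := gen_coshprod _ _ _ _; set Q := \sum_i _.
  (* The derivatives of the cutoff tend to -1 and 0, so the second-order term disappears in the
     limit. *)
  have -> : - L = -1 * L + kappa^-1 * (0 * W (X t w) ^+ 2 * Q) by ring.
  apply: cvgD.
    by apply: cvgM; [exact: cvg_dcutoff|exact: cvg_cst].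
  apply: cvgM; first exact: cvg_cst.
  apply: cvgM; last exact: cvg_cst.
  by apply: cvgM; [exact: cvg_ddcutoff|exact: cvg_cst].
- have := integrableZl measurableT C (integrable_coshprod t0).
  by apply: eq_integrable.
- by move=> n w _; case: (hC n.+1%:R (X t w) (ltr0Sn _ _)).
Qed.

(** The derivative identity is integrated in time because pointwise limits of derivatives need not
    be derivatives, while integrals pass to the limit by domination. *)
Lemma cutoff_FTC (m t : R) : 0 < m -> 0 < t ->
  \int[lebesgue_measure]_(s in `[0, t]) \int[P]_w Lm m (X (Num.max 0 s) w)
  = \int[P]_w cutoff m (W (X t w)) - cutoff m (W x).
Proof.
move=> m0 t0.
pose F (s : R) := \int[P]_w cutoff m (W (X (Num.max 0 s) w)).
pose f (s : R) := \int[P]_w Lm m (X (Num.max 0 s) w).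
have cF : continuous F := expectation_cutoff_continuous hX u_gt0 m0.
have cf : continuous f := expectation_gen_cutoff_continuous kappa_gt0 hX u_gt0 m0.
have dF (s : R) : 0 < s -> is_derive s 1 F (f s).
  move=> s0; have h := is_derive_expectation_cutoff kappa_gt0 hX u_gt0 m0 s0.
  have -> : f s = \int[P]_w Lm m (X s w) by rewrite /f max_r; [|exact: ltW].
  apply: (near_eq_is_derive _ h); near=> r.
  have r0 : 0 < r by near: r; exact: lt_nbhsr.
  by rewrite /F max_r; [|exact: ltW].
rewrite {1}/Rintegral (@continuous_FTC2 R f F 0 t t0).
- rewrite -EFinB.
  have -> : F 0 = cutoff m (W x).
    rewrite /F maxxx; exact: (expectation_cutoff_start hX).
  by have -> : F t = \int[P]_w cutoff m (W (X t w)) by rewrite /F max_r; [|exact: ltW].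
- exact: continuous_subspaceT.
- split.
  + by move=> s; rewrite in_itv/= => /andP[s0 _]; have [] := dF s s0.
  + by apply: cvg_at_right_filter; exact: cF.
  + by apply: cvg_at_left_filter; exact: cF.
- move=> s; rewrite in_itv/= => /andP[s0 _].
  by rewrite derive1E; have [_ ->] := dF s s0.
Unshelve. all: by end_near. Qed.

Lemma expectation_coshprod_integral (t : R) : 0 < t ->
  lebesgue_measure.-integrable `[0, t] (EFin \o (fun s => ell (Num.max 0 s))) /\
  \int[P]_w W (X t w)
  = W x + \int[lebesgue_measure]_(s in `[0, t]) ell (Num.max 0 s).
Proof.
move=> t0; have [C C0 hC] := @gen_cutoff_bounds R N u u_gt0 p q kappa kappa_gt0.
have [C' C'0 hC'] := coshprod_moment.
(* Dominates the expected generator of every cutoff at all times up to t: [C] bounds the generator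
   by W, and [C'] bounds the expectation of W. *)
pose K := C * (W x * expR (C' * t)).
have m0 (s : R) : 0 <= Num.max 0 s by rewrite le_max lexx.
have [] := @Rintegral_dominated_cvg _ _ R lebesgue_measure `[0, t]%classic
  (measurable_itv _) (fun n s => \int[P]_w Lm n.+1%:R (X (Num.max 0 s) w))
  (fun s => - ell (Num.max 0 s)) (fun=> K).
- move=> n; apply: measurable_funTS; apply: continuous_measurable_fun.
  exact: (expectation_gen_cutoff_continuous kappa_gt0 hX u_gt0).
- by move=> s _; exact: cvg_expectation_gen_cutoff.
- apply: continuous_compact_integrable; first exact: segment_compact.
  by apply: continuous_subspaceT => s; exact: cvg_cst.
- move=> n s /=; rewrite in_itv/= => /andP[s0 st]; rewrite max_r//.
  have n0 := ltr0Sn R n.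
  apply: le_trans (le_normr_Rintegral _ (ig n0 s0)) _ => //.
  apply: (@le_trans _ _ (\int[P]_w (C * W (X s w)))).
    apply: le_Rintegral => //.
    + by have := integrable_norm (ig n0 s0); apply: eq_integrable.
    + have := integrableZl measurableT C (integrable_coshprod s0).
      by apply: eq_integrable.
    + by move=> w _; case: (hC n.+1%:R (X s w) n0).
  rewrite RintegralZl//; last exact: integrable_coshprod.
  rewrite ler_wpM2l// (le_trans (hC' s s0).2)// ler_wpM2l//.
  by rewrite ler_expR ler_wpM2l.
move=> ih lim.
have ih' : lebesgue_measure.-integrable `[0, t] (EFin \o (fun s => ell (Num.max 0 s))).
  have := @integrableZl _ _ _ lebesgue_measure `[0, t]%classic (measurable_itv _) (-1) _ ih.
  by apply: eq_integrable => // s _ /=; rewrite -EFinM mulN1r opprK.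
split=> //.
have lim2 : (\int[P]_w cutoff n.+1%:R (W (X t w)) - cutoff n.+1%:R (W x))
    @[n --> \oo] --> W x - \int[P]_w W (X t w).
  (* The individual cutoff terms grow like m / 3; inserting m / 3 twice leaves two convergent
     gaps. *)
  have -> : (fun n => \int[P]_w cutoff n.+1%:R (W (X t w)) - cutoff n.+1%:R (W x))
    = (fun n => (n.+1%:R / 3 - cutoff n.+1%:R (W x))
        - \int[P]_w (n.+1%:R / 3 - cutoff n.+1%:R (W (X t w)))).
    apply/funext => n; rewrite expectation_gap ?(ltW t0)//; ring.
  apply: cvgB; first exact: cvg_cutoff_gap.
  by apply: cvg_expectation_cutoff_gap; exact: ltW.
have E : W x - \int[P]_w W (X t w)
    = \int[lebesgue_measure]_(s in `[0, t]) (- ell (Num.max 0 s)).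
  apply: (cvg_unique _ lim2) => //.
  have -> : (fun n => \int[P]_w cutoff n.+1%:R (W (X t w)) - cutoff n.+1%:R (W x))
    = (fun n => \int[lebesgue_measure]_(s in `[0, t])
         \int[P]_w Lm n.+1%:R (X (Num.max 0 s) w)).
    by apply/funext => n; rewrite cutoff_FTC.
  exact: lim.
have EN : \int[lebesgue_measure]_(s in `[0, t]) (- ell (Num.max 0 s))
    = - \int[lebesgue_measure]_(s in `[0, t]) ell (Num.max 0 s).
  rewrite -[RHS]mulN1r.
  rewrite -(@RintegralZl _ _ R lebesgue_measure `[0, t]%classic _ (-1) (measurable_itv _) ih').
  by apply: eq_Rintegral => s _; rewrite mulN1r.
by move: E; rewrite EN => /eqP; rewrite subr_eq => /eqP ->; ring.
Qed.

End DiffusionLimit.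

(** * Elementary symmetric polynomials and the polynomial flow *)

(** The ring is left general because the expansion is applied over the reals, over real polynomials
    and over the complex numbers. *)
Lemma prod_add_const (S : comNzRingType) (N : nat) (a : 'I_N -> S) (b : S) :
  \prod_(i < N) (b + a i) = \sum_(n < N.+1)
    (\sum_(J : {set 'I_N} | #|J| == n) \prod_(i in J) a i) * b ^+ (N - n).
Proof.
under eq_bigr do rewrite addrC.
rewrite bigA_distr (partition_big (fun J : {set 'I_N} => inord #|J| : 'I_N.+1) predT)//=.
apply: eq_bigr => n _; rewrite mulr_suml.
have cJ (J : {set 'I_N}) : (#|J| < N.+1)%N.
  by rewrite ltnS -[leqRHS](card_ord N) max_card.
apply: eq_big => [J|J /eqP <-]; first by rewrite -val_eqE/= inordK.
rewrite inordK// (bigID (fun i => i \in J))/=; congr (_ * _).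
  by apply: eq_bigr => i ->.
under eq_bigr => i /negbTE -> do [].
rewrite prodr_const; congr (_ ^+ _).
apply: (@addnI #|J|); rewrite subnKC; last by rewrite -ltnS.
by rewrite -[RHS]card_ord -(cardC (mem J)); congr addn; exact: eq_card.
Qed.

Section ElementarySymmetric.
Context {R : realType} {N : nat}.
Implicit Types x z : 'rV[R]_N.

Lemma elem_symE n z : elem_sym n z
  = \sum_(J : {set 'I_N} | #|J| == n) \prod_(i in J) z 0 i.
Proof.
rewrite /elem_sym mpoly.mesymE.
rewrite (big_morph _ (@mpoly.mevalD N R (fun i => z 0 i)) (@mpoly.meval0 N R _)).
apply: eq_bigr => J _.
rewrite mpoly.mevalX [RHS]big_mkcond/=; apply: eq_bigr => i _.
by rewrite mpoly.mnmE; case: (i \in J).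
Qed.

Lemma elem_sym_coshv_ge0 n x : 0 <= elem_sym n (coshv x).
Proof.
rewrite elem_symE sumr_ge0// => J _; rewrite prodr_ge0// => i _.
by rewrite mxE (le_trans ler01)// cosh_ge1.
Qed.

Lemma coshprod_elem_sym u x : coshprod u x
  = \sum_(n < N.+1) elem_sym n (coshv x) * u ^+ (N - n).
Proof.
rewrite /coshprod prod_add_const; apply: eq_bigr => n _.
rewrite elem_symE; congr (_ * _); apply: eq_bigr => J _.
by apply: eq_bigr => i _; rewrite mxE.
Qed.

Lemma elem_sym_coshv_le n x : (n <= N)%N ->
  elem_sym n (coshv x) <= coshprod 1 x.
Proof.
move=> nN; rewrite coshprod_elem_sym.
rewrite (bigD1 (Ordinal (nN : (n < N.+1)%N)))//= expr1n mulr1 lerDl sumr_ge0// => i _.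
by rewrite expr1n mulr1 elem_sym_coshv_ge0.
Qed.

Definition cosh_poly x : {poly R} :=
  \poly_(k < N.+1) elem_sym (N - k) (coshv x).

Lemma cosh_polyE x : cosh_poly x = \prod_(i < N) ('X + (cosh (x 0 i))%:P).
Proof.
rewrite prod_add_const /cosh_poly poly_def (reindex_inj rev_ord_inj)/=.
apply: eq_bigr => n _; rewrite subSS subKn; last by rewrite -ltnS.
rewrite -mul_polyC elem_symE rmorph_sum/=; congr (_ * _); apply: eq_bigr => J _.
by rewrite rmorph_prod; apply: eq_bigr => i _; rewrite mxE.
Qed.

Lemma horner_cosh_poly u x : (cosh_poly x).[u] = coshprod u x.
Proof.
rewrite cosh_polyE horner_prod; apply: eq_bigr => i _.
by rewrite hornerD hornerX hornerC.
Qed.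

(** Here S1 = f'/f and S1' = - S2, whence f''/f = S1^2 - S2. *)
Lemma deriv_prod_log (I : Type) (s : seq I) (c : I -> R) (u : R) :
  (forall i, u + c i != 0) ->
  let f := \prod_(i <- s) ('X + (c i)%:P) in
  let S1 := \sum_(i <- s) (u + c i)^-1 in
  let S2 := \sum_(i <- s) (u + c i)^-1 ^+ 2 in
  f^`().[u] = f.[u] * S1 /\ f^`(2).[u] = f.[u] * (S1 ^+ 2 - S2).
Proof.
move=> uc /=; elim: s => [|i s [IH1 IH2]].
  rewrite !big_nil -polyC1 derivC linear0 !hornerE.
  by rewrite expr0n/= subrr.
rewrite !big_cons; set f := \prod_(j <- s) _ in IH1 IH2 *.
have d1 : ('X + (c i)%:P)^`() = 1 :> {poly R} by rewrite derivD derivX derivC addr0.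
have df : (('X + (c i)%:P) * f)^`() = f + ('X + (c i)%:P) * f^`().
  by rewrite derivM d1 mul1r.
have d2f : ((('X + (c i)%:P) * f)^`())^`()
    = 2%:R *: f^`() + ('X + (c i)%:P) * (f^`())^`().
  rewrite df derivD derivM d1 mul1r addrA.
  by rewrite -mulr2n -scaler_nat.
rewrite d2f df !hornerE IH1 IH2; have uci := uc i.
by split; field.
Qed.

(* The action of the generator on [cosh_poly]; it does not involve [kappa]. *)
Definition gen_poly (p q : R) (f : {poly R}) : {poly R} :=
  (q - p) *: (N%:R *: f + (1 - 'X) * f^`())
  + (2 * (p - (N%:R - 1))) *: (N%:R *: f - 'X * f^`())
  + (N%:R * (N%:R - 1)) *: f + (1 - 'X ^+ 2) * f^`(2).

Lemma horner_gen_poly p q u x : 0 < u ->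
  (gen_poly p q (cosh_poly x)).[u] = gen_coshprod u p q x.
Proof.
move=> u0.
have uc (i : 'I_N) : u + cosh (x 0 i) != 0 by rewrite gt_eqF// add_cosh_gt0.
have [d1 d2] := deriv_prod_log (index_enum _) uc.
rewrite /gen_coshprod -horner_cosh_poly /gen_poly !hornerE.
move: d1 d2; rewrite -cosh_polyE => -> ->.
rewrite -/(recip_sum u x) -/(recip_sqr_sum u x).
by ring.
Qed.

Lemma coef_gen_poly p q f k : (gen_poly p q f)`_k =
  ((q - p) * (N%:R - k%:R) + 2 * (p - (N%:R - 1)) * (N%:R - k%:R)
    + N%:R * (N%:R - 1) - k%:R * (k%:R - 1)) * f`_k
  + (q - p) * k.+1%:R * f`_k.+1 + k.+2%:R * k.+1%:R * f`_k.+2.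
Proof.
have cX g : ('X * g^`())`_k = k%:R * g`_k :> R.
  rewrite coefXM; case: k => [|k] /=; first by rewrite mul0r.
  by rewrite coef_deriv mulr_natl.
have cX2 : ('X ^+ 2 * f^`(2))`_k = k%:R * (k%:R - 1) * f`_k.
  (* For k = 0 and k = 1 the shifted coefficient is 0, as is the factor k (k - 1). *)
  rewrite coefXnM; case: k {cX} => [|[|k]] /=; rewrite ?mul0r ?subrr ?mulr0 ?mul0r//.
  rewrite -addn2 addnK addn2 !coef_deriv.
  rewrite -(mulr_natl (f`_k.+2)) -(mulr_natl (_ * f`_k.+2)).
  by rewrite -[k.+2%:R]natr1; ring.
rewrite /gen_poly !mulrBl !mul1r !coefD !coefN !coefZ !coefD !coefN !coefZ cX cX2.
rewrite -[f^`(2)]/((f^`())^`()) !coef_deriv.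
rewrite -(mulr_natl (f`_k.+2)) -(mulr_natl (_ * f`_k.+2)) -(mulr_natl (f`_k.+1)).
by ring.
Qed.

Lemma gen_polyP p q a f g :
  gen_poly p q (a *: f + g) = a *: gen_poly p q f + gen_poly p q g.
Proof. by apply/polyP => k; rewrite !(coefD, coefZ, coef_gen_poly); ring. Qed.

Lemma size_gen_poly p q (f : {poly R}) : (size f <= N.+1)%N -> (size (gen_poly p q f) <= N.+1)%N.
Proof.
move=> /leq_sizeP sf; apply/leq_sizeP => k Nk.
by rewrite coef_gen_poly !sf ?mulr0 ?addr0// (leq_trans Nk)// ?leqW.
Qed.

Lemma horner_gen_poly_sum p q u (c : nat -> R) :
  (gen_poly p q (\poly_(k < N.+1) c k)).[u]
  = \sum_(k < N.+1) c k * (gen_poly p q 'X^k).[u].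
Proof.
rewrite poly_def; elim/big_rec2: _ => [|k y f _ <-].
  (* Linearity with scalar -1 at the zero polynomial shows that 0 is sent to 0. *)
  have := gen_polyP p q (-1) 0 0.
  by rewrite scaler0 addr0 scaleN1r addNr => ->; rewrite horner0.
by rewrite gen_polyP hornerD hornerZ.
Qed.

End ElementarySymmetric.

(** Inverts the Vandermonde matrix of the nodes 1, ..., n. The nodes are positive since evaluations
    are controlled for u > 0 only; continuity and derivatives then pass from evaluations to
    coefficients. *)
Lemma coef_interpolation (R : realType) (n : nat) :
  exists L : 'I_n -> nat -> R, forall f : {poly R}, (size f <= n)%N ->
    forall k, f`_k = \sum_(j < n) L j k * f.[j.+1%:R].
Proof.
pose a := \row_(j < n) (j.+1%:R : R).
pose V := Vandermonde n a.
have Vu : V \in unitmx.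
  rewrite unitmxE det_Vandermonde unitfE; apply/prodf_neq0 => i _.
  apply/prodf_neq0 => j ij; rewrite !mxE subr_eq0 eqr_nat eqSS.
  by rewrite gtn_eqF.
(* Beyond the size bound the weights are 0, matching the default coefficient of a polynomial. *)
exists (fun j k => if insub k is Some k' then invmx V j k' else 0) => f sf k.
case: insubP => [k' kn k'k|]; last first.
  rewrite -leqNgt => nk; rewrite big1 ?nth_default ?(leq_trans sf)// => j _.
  by rewrite mul0r.
have e : \row_j f.[j.+1%:R] = (\row_(i < n) f`_i) *m V.
  apply/rowP => j; rewrite !mxE (horner_coef_wide _ sf).
  by apply: eq_bigr => i _; rewrite !mxE.
have : (\row_j f.[j.+1%:R]) *m invmx V = \row_(i < n) f`_i by rewrite e mulmxK.
move=> /rowP/(_ k'); rewrite !mxE k'k => <-.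
by apply: eq_bigr => j _; rewrite mxE mulrC.
Qed.

(** * The linear differential equation for polynomials *)

Section PolynomialFlow.
Context {R : realType} {N : nat}.
Variables (p q : R).

Lemma is_derive_linear_comb (n : nat) (c : 'I_n -> R) (h : 'I_n -> R -> R)
    (dh : 'I_n -> R) (t : R) :
  (forall j, is_derive t 1 (h j) (dh j)) ->
  is_derive t 1 (fun s => \sum_(j < n) c j * h j s) (\sum_(j < n) c j * dh j).
Proof.
move=> hdh.
have -> : (fun s => \sum_(j < n) c j * h j s) = \sum_(j < n) (fun s => c j * h j s).
  by apply/funext => s; rewrite fct_sumE.
have hc j : is_derive t 1 (fun s => c j * h j s) (c j * dh j).
  apply: (is_derive_val (is_derive_mul (is_derive_cst (c j) t 1) (hdh j))).
  by rewrite mul0r add0r.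
exact: is_derive_sum hc.
Qed.

Lemma within_continuous_linear_comb (n : nat) (A : set R) (c : 'I_n -> R)
    (h : 'I_n -> R -> R) :
  (forall j, {within A, continuous (h j)}) ->
  {within A, continuous (fun s => \sum_(j < n) c j * h j s)}.
Proof.
elim: n c h => [|n IH] c h ch.
  under eq_fun do rewrite big_ord0.
  exact: (@continuous_const R (subspace A)).
under eq_fun do rewrite big_ord_recl.
apply: (@continuous_addf R (subspace A)).
  by apply: (@continuous_mulf R (subspace A)); [exact: continuous_const|exact: ch].
by apply: IH => j; exact: ch.
Qed.

(* A solution of [f' = gen_poly p q f] in polynomials of degree at most [N],
   expressed through point evaluations. *)
Definition poly_flow (f : R -> {poly R}) : Prop :=
  [/\ forall t, (size (f t) <= N.+1)%N,
      forall u t : R, 0 < u -> {within `[0, t], continuous (fun s => (f s).[u])} &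
      forall u t : R, 0 < u -> 0 < t ->
        is_derive t 1 (fun s => (f s).[u]) (@gen_poly R N p q (f t)).[u]].

Lemma poly_flow_coef (f : R -> {poly R}) k : poly_flow f ->
  (forall t : R, {within `[0, t], continuous (fun s => (f s)`_k)}) /\
  (forall t : R, 0 < t ->
     is_derive t 1 (fun s => (f s)`_k) (@gen_poly R N p q (f t))`_k).
Proof.
move=> [sf cf df]; have [L hL] := coef_interpolation R N.+1.
have -> : (fun s => (f s)`_k) = (fun s => \sum_(j < N.+1) L j k * (f s).[j.+1%:R]).
  by apply/funext => s; exact: hL.
split=> t; first by apply: within_continuous_linear_comb => j; exact: cf.
move=> t0; rewrite (hL _ (size_gen_poly _ _ (sf t))).
by apply: is_derive_linear_comb => j; exact: df.
Qed.

(* [gen_poly] is upper triangular in the basis of monomials, so the coefficients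
   of the difference vanish one after the other, starting from the top. *)
Lemma poly_flow_unique (f g : R -> {poly R}) : poly_flow f -> poly_flow g ->
  f 0 = g 0 -> forall t : R, 0 <= t -> f t = g t.
Proof.
move=> ff gg fg0 t t0; apply/polyP => k.
have [m] := ubnP (N.+1 - k)%N; elim: m k t t0 => // m IH k t t0 km.
have [kN|Nk] := ltnP N k.
  have [[sf _ _] [sg _ _]] := (ff, gg).
  by rewrite !nth_default// (leq_trans _ kN).
have [cf df] := poly_flow_coef k ff; have [cg dg] := poly_flow_coef k gg.
have e1 (s : R) : 0 <= s -> (f s)`_k.+1 = (g s)`_k.+1.
  move=> s0; apply: IH => //; rewrite subSS.
  by move: km; rewrite subSn.
have e2 (s : R) : 0 <= s -> (f s)`_k.+2 = (g s)`_k.+2.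
  move=> s0; apply: IH => //; rewrite subSS.
  by apply: leq_ltn_trans (leq_sub2l _ (leqnSn k)) _; move: km; rewrite subSn.
(* The diagonal entry at degree k; the entries in degrees k + 1 and k + 2 cancel in the difference
   by [e1] and [e2]. *)
pose lam := (q - p) * (N%:R - k%:R) + 2 * (p - (N%:R - 1)) * (N%:R - k%:R)
  + N%:R * (N%:R - 1) - k%:R * (k%:R - 1) : R.
(* Gronwall's lemma bounds from above only, so it is applied to the difference with both signs, e =
   1 and e = -1. *)
have le0 (e : R) : e * ((f t)`_k - (g t)`_k) <= 0.
  pose a (s : R) := e * ((f s)`_k - (g s)`_k).
  suff : a t <= a 0 * expR (lam * t).
    by rewrite [in X in _ <= X]/a fg0 subrr mulr0 mul0r.
  apply: (@gronwall_derive R a (fun s => lam * a s) lam t) => //.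
  - move=> s s0.
    apply: (is_derive_val (is_derive_mul (is_derive_cst e s 1)
       (is_deriveB (df s s0) (dg s s0)))).
    rewrite !coef_gen_poly e1 ?e2 ?(ltW s0)// -/lam /a /cst; ring.
  - apply: (@continuous_mulf R (subspace _)); first exact: continuous_const.
    by move=> s; apply: cvgB; [exact: cf|exact: cg].
have := le0 1; have := le0 (-1); lra.
Qed.

End PolynomialFlow.

Section DeterministicFlow.
Context {R : realType} {N : nat}.
Variables (p q : R) (x : 'rV[R]_N) (Y : R -> 'rV[R]_N).
Hypothesis hY : is_deterministic_solution p q x Y.

(** The ODE is used for t > 0, where [Y] is interior; at time 0 continuity suffices, which covers
    starting points on the walls. *)
Lemma poly_flow_deterministic : @poly_flow R N p q (fun t => cosh_poly (Y t)).
Proof.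
case: hY => Y0 cY iY dY; split.
- by move=> t; exact: size_poly.
- move=> u t u0.
  have -> : (fun s => (cosh_poly (Y s)).[u]) = (fun s => coshprod u (Y s)).
    by apply/funext => s; exact: horner_cosh_poly.
  have cYt : {within `[0, t], continuous Y}.
    by move: cY; apply: continuous_subspaceW => s /=; rewrite in_itv/= => /andP[].
  move=> s; exact: (cvg_comp _ (@coshprod R N u) (@cYt s) (@continuous_coshprod R N u _)).
- move=> u t u0 t0.
  have -> : (fun s => (cosh_poly (Y s)).[u]) = (fun s => coshprod u (Y s)).
    by apply/funext => s; exact: horner_cosh_poly.
  rewrite horner_gen_poly//.
  apply: (is_derive_val (is_derive_coshprod u0 (dY t t0))).
  rewrite (drift_sinh_ratio_sum _ _ u0 (iY t t0)) /gen_coshprod.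
  by ring.
Qed.

End DeterministicFlow.

(** * The polynomial of expected elementary symmetric functions *)

Section ExpectedPolynomial.
Context {R : realType} {N : nat} {d : measure_display} {T : measurableType d}.
Variables (P : probability T R) (p q kappa : R) (x : 'rV[R]_N) (X : R -> T -> 'rV[R]_N).
Hypothesis kappa_gt0 : 0 < kappa.
Hypothesis hX : is_diffusion P p q kappa x X.

Lemma measurable_elem_sym n (t : R) : 0 <= t ->
  measurable_fun setT (fun w => elem_sym n (coshv (X t w))).
Proof.
move=> t0; under eq_fun do rewrite elem_symE big_mkcond/=.
apply: measurable_sum => J; case: (#|J| == n); last exact: measurable_cst.
under eq_fun do rewrite big_mkcond/=.
apply: measurable_prod => i _; case: (i \in J); last exact: measurable_cst.
under eq_fun do rewrite mxE.
by apply: measurable_cosh_coord; exact: (diffusion_measurable hX).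
Qed.

Lemma integrable_elem_sym n (t : R) : (n <= N)%N -> 0 <= t ->
  P.-integrable setT (EFin \o (fun w => elem_sym n (coshv (X t w)))).
Proof.
move=> nN t0.
apply: (@le_integrable _ _ _ P setT measurableT _
    (EFin \o (fun w => coshprod 1 (X t w)))).
- by apply/measurable_EFinP; exact: measurable_elem_sym.
- move=> w _ /=; rewrite lee_fin ger0_norm ?elem_sym_coshv_ge0//.
  by rewrite (le_trans (elem_sym_coshv_le _ nN))// ler_norm.
- exact: (integrable_coshprod kappa_gt0 hX ltr01 t0).
Qed.

Lemma Rintegral_linear_comb (n : nat) (c : 'I_n -> R) (h : 'I_n -> T -> R) :
  (forall k, P.-integrable setT (EFin \o h k)) ->
  P.-integrable setT (EFin \o (fun w => \sum_(k < n) c k * h k w)) /\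
  \int[P]_w (\sum_(k < n) c k * h k w) = \sum_(k < n) c k * \int[P]_w h k w.
Proof.
elim: n c h => [|n IH] c h ih.
  rewrite big_ord0; under eq_Rintegral do rewrite big_ord0.
  rewrite expectation_const; split=> //.
  by under eq_fun do rewrite big_ord0; exact: integrable_const.
have [IH1 IH2] := IH (fun k => c (lift ord0 k)) (fun k => h (lift ord0 k)) (fun k => ih _).
have i0 : P.-integrable setT (EFin \o (fun w => c ord0 * h ord0 w)).
  by have := integrableZl measurableT (c ord0) (ih ord0); apply: eq_integrable.
rewrite big_ord_recl -IH2 -RintegralZl// -RintegralD//.
split; last by apply: eq_Rintegral => w _; rewrite big_ord_recl.
under eq_fun do rewrite big_ord_recl.
by have := integrableD measurableT i0 IH1; apply: eq_integrable.
Qed.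

Definition expected_poly (t : R) : {poly R} :=
  \poly_(k < N.+1) \int[P]_w elem_sym (N - k) (coshv (X t w)).

Lemma horner_expected_poly (u t : R) : 0 <= t ->
  (expected_poly t).[u] = \int[P]_w coshprod u (X t w).
Proof.
move=> t0.
have -> : (fun w => coshprod u (X t w)) = (fun w => \sum_(k < N.+1)
    u ^+ k * elem_sym (N - k) (coshv (X t w))).
  apply/funext => w; rewrite -horner_cosh_poly horner_poly.
  by apply: eq_bigr => k _; rewrite mulrC.
rewrite (Rintegral_linear_comb _ _).2; last first.
  by move=> k; apply: integrable_elem_sym => //; exact: leq_subr.
by rewrite horner_poly; apply: eq_bigr => k _; rewrite mulrC.
Qed.

(** The generator acts linearly on the span of the e_n, so it commutes with the expectation; this
    closes the equation for [expected_poly]. *)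
Lemma horner_gen_expected_poly (u t : R) : 0 < u -> 0 <= t ->
  (@gen_poly R N p q (expected_poly t)).[u] = \int[P]_w gen_coshprod u p q (X t w).
Proof.
move=> u0 t0.
have -> : (fun w => gen_coshprod u p q (X t w)) = (fun w => \sum_(k < N.+1)
    (@gen_poly R N p q 'X^k).[u] * elem_sym (N - k) (coshv (X t w))).
  apply/funext => w; rewrite -horner_gen_poly// horner_gen_poly_sum.
  by apply: eq_bigr => k _; rewrite mulrC.
rewrite (Rintegral_linear_comb _ _).2; last first.
  by move=> k; apply: integrable_elem_sym => //; exact: leq_subr.
by rewrite horner_gen_poly_sum; apply: eq_bigr => k _; rewrite mulrC.
Qed.

Lemma expectation_coshprod_start (u : R) :
  \int[P]_w coshprod u (X 0 w) = coshprod u x.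
Proof.
case: hX => _ _ _ X0 _; apply: expectation_ae_const.
  by apply: measurable_coshprod; exact: (diffusion_measurable hX).
by apply: filterS X0 => w /= ->.
Qed.

Lemma expected_poly_start : expected_poly 0 = cosh_poly x.
Proof.
rewrite /expected_poly /cosh_poly; apply/polyP => k.
rewrite !coef_poly; case: ifP => // _.
case: hX => _ _ _ X0 _; apply: expectation_ae_const.
  exact: measurable_elem_sym.
by apply: filterS X0 => w /= ->.
Qed.

Lemma within_continuous_expectation_coshprod (u t : R) : 0 < u ->
  {within `[0, t], continuous (fun s => \int[P]_w coshprod u (X s w))}.
Proof.
move=> u0; have [t0|t0|<-] := ltgtP 0 t; last 2 first.
- by rewrite set_itv_ge -?ltNge//; exact: continuous_subspace0.
- by rewrite set_itv1; exact: continuous_subspace1.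
have [ie _] := expectation_coshprod_integral kappa_gt0 hX u0 t0.
have cI := parameterized_integral_continuous (ltW t0) ie.
apply: (@subspace_eq_continuous _ _ _ (fun s : R => coshprod u x
  + \int[lebesgue_measure]_(r in `[0, s])
      \int[P]_w gen_coshprod u p q (X (Num.max 0 r) w))); last first.
  apply: (@continuous_addf R (subspace _)); first exact: continuous_const.
  exact: cI.
move=> s; rewrite inE/= in_itv/= => /andP[]; rewrite le_eqVlt => /predU1P[<- _|s0 _].
  rewrite set_itv1 Rintegral_set1 addr0.
  exact/esym/expectation_coshprod_start.
by have [_ E] := expectation_coshprod_integral kappa_gt0 hX u0 s0; exact/esym.
Qed.

(** A bootstrap: the integral identity gives continuous evaluations, interpolation gives continuous
    coefficients, so the integrand is continuous and the identity can be differentiated. *)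
Lemma poly_flow_expected : @poly_flow R N p q expected_poly.
Proof.
have cW (u t : R) : 0 < u -> {within `[0, t], continuous (fun s => (expected_poly s).[u])}.
  move=> u0; apply: (@subspace_eq_continuous _ _ _
      (fun s => \int[P]_w coshprod u (X s w))).
    move=> s; rewrite inE/= in_itv/= => /andP[s0 _].
    exact/esym/horner_expected_poly.
  exact: within_continuous_expectation_coshprod.
split=> // [t|u t u0 t0]; first exact: size_poly.
have [L hL] := coef_interpolation R N.+1.
have sE s : (size (expected_poly s) <= N.+1)%N by exact: size_poly.
have cE k : {within `[0, t + 1], continuous (fun s => (expected_poly s)`_k)}.
  have -> : (fun s => (expected_poly s)`_k)
      = (fun s => \sum_(j < N.+1) L j k * (expected_poly s).[j.+1%:R]).
    by apply/funext => s; exact: hL.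
  by apply: within_continuous_linear_comb => j; exact: cW.
pose ell (s : R) := (@gen_poly R N p q (expected_poly s)).[u].
have cell : {within `[0, t + 1], continuous ell}.
  have -> : ell = (fun s => \sum_(k < N.+1)
     (@gen_poly R N p q 'X^k).[u] * (expected_poly s)`_k).
    apply/funext => s; rewrite /ell horner_gen_poly_sum; apply: eq_bigr => k _.
    by rewrite mulrC coef_poly ltn_ord.
  by apply: within_continuous_linear_comb => k; exact: cE.
(* The interval extends beyond t to make t an interior point. *)
have tt1 : t < t + 1 by rewrite ltrDl.
have t01 : 0 < t + 1 by rewrite addr_gt0.
have [] := @continuous_FTC1 R ell (BLeft 0) t (t + 1) tt1.
- by apply: continuous_compact_integrable; [exact: segment_compact|exact: cell].
- by [].
- by apply: (within_continuous_continuous t01 cell); rewrite in_itv/= t0.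
move=> dI eI.
have dF : is_derive t 1 (fun s : R => \int[lebesgue_measure]_(r in `[0, s]) ell r) (ell t).
  by apply: DeriveDef; [exact: dI|rewrite -derive1E; exact: eI].
have dWF := is_derive_val (is_derive_add (is_derive_cst (coshprod u x) t 1) dF) (add0r _).
apply: near_eq_is_derive dWF; near=> s.
have s0 : 0 < s by near: s; exact: lt_nbhsr.
rewrite horner_expected_poly ?(ltW s0)//.
have [_ ->] := expectation_coshprod_integral kappa_gt0 hX u0 s0.
congr (_ + _); apply: eq_Rintegral => r; rewrite inE/= in_itv/= => /andP[r0 _].
rewrite (max_r r0); exact: horner_gen_expected_poly.
Unshelve. all: by end_near. Qed.

End ExpectedPolynomial.

(** * Comparison of coefficients and complex arguments *)

Local Open Scope complex_scope.

Section MainResult.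
Context {R : realType} {N : nat} {d : measure_display} {T : measurableType d}.
Variables (P : probability T R) (p q kappa : R) (x : 'rV[R]_N).
Variables (X : R -> T -> 'rV[R]_N) (Y : R -> 'rV[R]_N).
Hypothesis kappa_gt0 : 0 < kappa.
Hypothesis hX : is_diffusion P p q kappa x X.
Hypothesis hY : is_deterministic_solution p q x Y.

Lemma expectation_elem_sym_deterministic (t : R) n : 0 <= t -> (n <= N)%N ->
  \int[P]_w elem_sym n (coshv (X t w)) = elem_sym n (coshv (Y t)).
Proof.
move=> t0 nN.
have Y0 : expected_poly P X 0 = cosh_poly (Y 0).
  by rewrite (expected_poly_start hX); case: hY => ->.
have := poly_flow_unique (poly_flow_expected kappa_gt0 hX)
  (poly_flow_deterministic hY) Y0 t0.
move=> /(congr1 (fun f : {poly R} => f`_(N - n))).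
by rewrite /expected_poly /cosh_poly !coef_poly ltnS leq_subr subKn.
Qed.

End MainResult.

Lemma prod_sub_elem_sym (R : realType) (N : nat) (y : R[i]) (z : 'rV[R]_N) :
  \prod_(j < N) (y - (z 0 j)%:C) =
  \sum_(0 <= n < N.+1) (-1) ^+ n * (elem_sym n z)%:C * y ^+ (N - n).
Proof.
rewrite prod_add_const big_mkord; apply: eq_bigr => n _; congr (_ * _).
rewrite elem_symE rmorph_sum mulr_sumr; apply: eq_bigr => J /eqP Jn.
by rewrite prodrN Jn rmorph_prod.
Qed.

(** Integrability is part of the conclusion because [fine] maps infinite values to 0: it ensures
    that the equations speak of genuine expectations. *)
Theorem mainTheorem14 (R : realType) (N : nat) (hN : (2 <= N)%N)
    (x : 'rV[R]_N) (hx : weylB R N x) (p q : R)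
    (kappa : R) (hkappa : 0 < kappa)
    (hp : N%:R - 1 + (2 * kappa)^-1 <= p) (hq : p <= q)
    (d : measure_display) (T : measurableType d) (P : probability T R)
    (X : R -> T -> 'rV[R]_N) (hX : is_diffusion P p q kappa x X)
    (Y : R -> 'rV[R]_N) (hY : is_deterministic_solution p q x Y)
    (t : R) (ht : 0 <= t) (y : R[i]) :
  (cintegrable P (fun w => \prod_(j < N) (y - (cosh (X t w 0 j))%:C)) /\
   forall n, (n <= N)%N ->
     P.-integrable setT (EFin \o (fun w => elem_sym n (coshv (X t w))))) /\
  [/\ cexpectation P (fun w => \prod_(j < N) (y - (cosh (X t w 0 j))%:C))
      = \sum_(0 <= n < N.+1)
          (-1) ^+ n * (fine 'E_P[fun w => elem_sym n (coshv (X t w))])%:C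
          * y ^+ (N - n),
      \sum_(0 <= n < N.+1)
          (-1) ^+ n * (fine 'E_P[fun w => elem_sym n (coshv (X t w))])%:C
          * y ^+ (N - n)
      = \sum_(0 <= n < N.+1)
          (-1) ^+ n * (elem_sym n (coshv (Y t)))%:C * y ^+ (N - n) &
      \sum_(0 <= n < N.+1)
          (-1) ^+ n * (elem_sym n (coshv (Y t)))%:C * y ^+ (N - n)
      = \prod_(j < N) (y - (cosh (Y t 0 j))%:C)].
Proof.
have ie n (nN : (n <= N)%N) := integrable_elem_sym hkappa hX nN ht.
have ie' (k : 'I_N.+1) : P.-integrable setT (EFin \o
  (fun w => elem_sym k (coshv (X t w)))) by apply: ie; rewrite -ltnS.
have EE n : fine 'E_P[fun w => elem_sym n (coshv (X t w))]
    = \int[P]_w elem_sym n (coshv (X t w)).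
  by rewrite unlock.
have prodE (z : 'rV[R]_N) : \prod_(j < N) (y - (cosh (z 0 j))%:C)
    = \sum_(0 <= n < N.+1) (-1) ^+ n * (elem_sym n (coshv z))%:C * y ^+ (N - n).
  by rewrite -prod_sub_elem_sym; apply: eq_bigr => j _; rewrite mxE.
(* Only these coefficients are complex; real and imaginary parts of the product are real linear
   combinations of the e_n, to which the real expectation applies. *)
pose c (k : 'I_N.+1) : R[i] := (-1) ^+ k * y ^+ (N - k).
have cE (e : nat -> R) : \sum_(0 <= n < N.+1) (-1) ^+ n * (e n)%:C * y ^+ (N - n)
    = Complex (\sum_(k < N.+1) complex.Re (c k) * e k)
              (\sum_(k < N.+1) complex.Im (c k) * e k).
  rewrite big_mkord; elim/big_rec3: _ => [//|k a b z _ ->].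
  rewrite mulrAC -/(c k); case: (c k) => r i.
  by apply/eqP; rewrite eq_complex /=; apply/andP; split; apply/eqP; ring.
have ReE : (fun w => complex.Re (\prod_(j < N) (y - (cosh (X t w 0 j))%:C)))
    = (fun w => \sum_(k < N.+1) complex.Re (c k) * elem_sym k (coshv (X t w))).
  by apply/funext => w; rewrite prodE (cE (fun n => elem_sym n (coshv (X t w)))).
have ImE : (fun w => complex.Im (\prod_(j < N) (y - (cosh (X t w 0 j))%:C)))
    = (fun w => \sum_(k < N.+1) complex.Im (c k) * elem_sym k (coshv (X t w))).
  by apply/funext => w; rewrite prodE (cE (fun n => elem_sym n (coshv (X t w)))).
have [iRe ERe] := Rintegral_linear_comb (fun k => complex.Re (c k)) ie'.
have [iIm EIm] := Rintegral_linear_comb (fun k => complex.Im (c k)) ie'.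
split; first by split=> //; split; rewrite ?ReE ?ImE.
split; last by rewrite prodE.
- rewrite (cE (fun n => fine 'E_P[fun w => elem_sym n (coshv (X t w))])).
  rewrite /cexpectation ReE ImE unlock.
  by rewrite -![fine _]/(Rintegral _ _ _) ERe EIm.
- rewrite !big_mkord; apply: eq_bigr => n _; rewrite EE.
  by rewrite (expectation_elem_sym_deterministic hkappa hX hY ht)// -ltnS.
Qed.
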